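(* For every $t\ge0$, every probability measure $\mu$ on $E$ and every nonnegative measurable function $f:\mathbb D([0,t],E\times\mathbb R)\to\mathbb R_+$, $$\frac{\mathbb E_\mu\Big[\sum_{u\in V_t}f\big(\widetilde X^u_{[0,t]}\big)\Big]}{\mathbb E[N_t]}=\mathbb E_\mu\big[f(\widetilde Y_{[0,t]})\big].$$
   Context: Tree. $\mathbb N=\{0,1,\dots\}$, $\mathbb N^*=\{1,2,\dots\}$, $\mathcal U=\bigcup_{n\ge0}(\mathbb N^* )^n$ (finite words, $(\mathbb N^* )^0=\{\varnothing\}$); $u\preceq v$ means $v=uw$ for some $w\in\mathcal U$, and $u\prec v$ means $u\preceq v$, $u\ne v$. Fix $r>0$ and an offspring distribution $p=(p_k,k\in\mathbb N)$ with $p_1=0$, finite second moment and mean $m=\sum_k kp_k>0$. Let $(\nu_u)_{u\in\mathcal U}$ be i.i.d. of law $p$, independent of $(l_u)_{u\in\mathcal U}$ i.i.d. exponential of mean $1/r$. $\mathcal T$ is the random set of $u=(u_1,\dots,u_n)\in\mathcal U$ with $u_{i+1}\le\nu_{(u_1,\dots,u_i)}$ for all $0\le i<n$. $\alpha(u)=\sum_{v\prec u}l_v$, $\beta(u)=\alpha(u)+l_u$. $V_t=\{u\in\mathcal T:\alpha(u)\le t<\beta(u)\}$, $N_t=\mathrm{Card}(V_t)$; $\mathbb E[N_t]=e^{r(m-1)t}$. For $u\in\mathcal T$ and $t<\beta(u)$, $u(t)$ is the ancestor $v\preceq u$ with $\alpha(v)\le t<\beta(v)$, and $\Lambda^u_t=\sum_{v\prec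 u(t)}\log(\nu_v)$. Branching Markov process. $E$ is a Polish space, $X=(X_t)_{t\ge0}$ a càdlàg $E$-valued strong Markov process, $F_j^{(k)}:E\times[0,1]\to E$ ($1\le j\le k$, $k\in\mathbb N^*$) measurable functions. Under $\mathbb P_\mu$, given the tree, the root's position $(X^\varnothing_t)_{0\le t<\beta(\varnothing)}$ evolves as $X$ with initial law $\mu$. When $u\in\mathcal T$ dies with $\nu_u=k\ge1$ offspring, its children $u1,\dots,uk$ start at time $\beta(u)$ from positions $F^{(k)}_j(X^u_{\beta(u)-},\Theta_u)$, $1\le j\le k$, with $\Theta_u$ an independent uniform variable on $[0,1]$; conditionally on these positions the children and their descendances evolve independently in the same way. For $u\in\mathcal T$ and $t<\alpha(u)$, $X^u_t:=X^{u(t)}_t$. Put $\widetilde X^u_t=(X^u_t,\Lambda^u_t)$ and, for a path $h$ and an interval $I$, $h_I=(h(s),s\in I)$. Auxiliary process. Let $S$ be a Poisson process with intensity $rm$ and $(H_k)_{k\ge1}$ i.i.d., independent of $S$, with $\mathbb P(H_k=h)=hp_h/m$; $\Lambda_t=\sum_{k=1}^{S_t}\log H_k$. Given these, $I_k$ are independent, $I_k$ uniform on $\{1,\dots,H_k\}$. $Y$ starts with law $\mu$ (under $\mathbb E_\mu$), evolves as $X$ between jump times of $S$, and at the $k$-th jump time $\tau_k$ of $S$ is set to $F^{(H_k)}_{I_k}(Y_{\tau_k-},\Theta_k)$ with $\Theta_k$ an independent uniform variable on $[0,1]$. $\widetilde Y=(Y,\Lambda)$. *)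

(* Defs.v *)
From HB Require Import structures.
From mathcomp Require Import all_boot all_order all_algebra.
From mathcomp Require Import all_classical all_reals all_analysis.
From mathcomp Require Import lra.
Import Order.TTheory GRing.Theory Num.Theory.
Import numFieldNormedType.Exports.

Set Implicit Arguments.
Unset Strict Implicit.
Unset Printing Implicit Defensive.

Local Open Scope classical_set_scope.
Local Open Scope ring_scope.

HB.instance Definition _ (S T : ptopologicalType) :=
  Topological.on (S * T)%type.

Definition borel (S : ptopologicalType) := g_sigma_algebraType (@open S).

HB.instance Definition _ (S : ptopologicalType) :=
  Measurable.on (borel S).

Definition polish (R : realType) (E : topologicalType) : Prop :=
  (exists2 D : set E, countable D & dense D) /\
  exists dist : E -> E -> R,
    [/\ [/\ forall x y, 0 <= dist x y,
            forall x y, dist x y = 0 <-> x = y,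
            forall x y, dist x y = dist y x &
            forall x y z, dist x z <= dist x y + dist y z],
        forall x (U : set E), nbhs x U <->
          exists2 e : R, 0 < e & [set y | dist x y < e] `<=` U &
        forall v : nat -> E,
          (forall e : R, 0 < e -> exists N : nat, forall m n : nat,
            (N <= m)%N -> (N <= n)%N -> dist (v m) (v n) < e) ->
          exists x : E, v @ \oo --> x].

Section cadlag_paths.
Context {R : realType} (I : set R).

Definition left_of (s : I) : set_system I :=
  within [set x : I | sval x < sval s] (nbhs s).
Definition right_of (s : I) : set_system I :=
  within [set x : I | sval s < sval x] (nbhs s).

(* When s is the least (greatest) element of I, left_of s (right_of s) is the
   improper filter, and the corresponding condition is void. *)
Definition cadlag (S : topologicalType) (h : I -> S) : Prop :=
  forall s : I, h @ right_of s --> h s /\ exists x : S, h @ left_of s --> x.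

(* The elements of D(I, S). *)
Record cadlag_path (S : topologicalType) :=
  CadlagPath { path_fun :> I -> S ; cadlagP : cadlag path_fun }.

HB.instance Definition _ S := gen_eqMixin (cadlag_path S).
HB.instance Definition _ S := gen_choiceMixin (cadlag_path S).

Lemma cadlag_cst (S : topologicalType) (x : S) : cadlag (fun=> x).
Proof.
move=> s; split; last exists x.
- move=> U /nbhs_singleton Ux; rewrite nbhs_simpl /right_of /within /=.
  by apply: nearW.
- move=> U /nbhs_singleton Ux; rewrite nbhs_simpl /left_of /within /=.
  by apply: nearW.
Qed.

HB.instance Definition _ (S : ptopologicalType) :=
  isPointed.Build (cadlag_path S) (CadlagPath (@cadlag_cst S point)).

(* D(I, S) carries the sigma-algebra generated by the coordinate maps; for
   Polish S it is the Borel sigma-algebra of the Skorokhod topology. *)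
Definition cylinders (S : ptopologicalType) : set (set (cadlag_path S)) :=
  \bigcup_(s in [set: I])
    preimage_set_system [set: cadlag_path S] (fun h : cadlag_path S => h s)
      (@measurable _ (borel S)).

HB.instance Definition _ (S : ptopologicalType) :=
  @isMeasurable.Build (sigma_display (@cylinders S)) (cadlag_path S)
    <<s @cylinders S >> (@sigma_algebra0 _ setT (@cylinders S))
    (@sigma_algebraC (cadlag_path S) (@cylinders S))
    (@sigma_algebra_bigcup _ setT (@cylinders S)).

Lemma nbhs_timeP (s : I) (U : set I) :
  nbhs s U <-> exists2 e : R, 0 < e &
    forall x : I, `|sval s - sval x| < e -> U x.
Proof.
split.
  by move=> /nbhs_ballP[e /= e0 sU]; exists e => // x xe; exact: sU.
by move=> [e e0 sU]; apply/nbhs_ballP; exists e => //= x xe; exact: sU.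
Qed.

Lemma cvg_right_ofP (S : topologicalType) (h : I -> S) (s : I) (y : S) :
  h @ right_of s --> y <-> forall U, nbhs y U ->
    exists2 e : R, 0 < e &
      forall x : I, sval s < sval x -> sval x < sval s + e -> U (h x).
Proof.
split=> [hy U /hy|hy U /hy[e e0 eU]].
  rewrite nbhs_simpl /right_of /within /= => /nbhs_timeP[e e0 eU].
  exists e => // x sx xs; apply: eU => //.
  by rewrite distrC ger0_norm; lra.
rewrite nbhs_simpl /right_of /within /=; apply/nbhs_timeP.
exists e => // x; rewrite distrC => /ltr_normlP[_ xs] sx; apply: eU => //; lra.
Qed.

Lemma cvg_left_ofP (S : topologicalType) (h : I -> S) (s : I) (y : S) :
  h @ left_of s --> y <-> forall U, nbhs y U ->
    exists2 e : R, 0 < e &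
      forall x : I, sval s - e < sval x -> sval x < sval s -> U (h x).
Proof.
split=> [hy U /hy|hy U /hy[e e0 eU]].
  rewrite nbhs_simpl /left_of /within /= => /nbhs_timeP[e e0 eU].
  exists e => // x sx xs; apply: eU => //.
  by rewrite ger0_norm; lra.
rewrite nbhs_simpl /left_of /within /=; apply/nbhs_timeP.
exists e => // x => /ltr_normlP[_ xs] sx; apply: eU => //; lra.
Qed.

Lemma cadlag_pair (S T : topologicalType) (h : cadlag_path S) (c : T) :
  cadlag (fun s => (h s, c)).
Proof.
move=> s; have [hr [x hl]] := cadlagP h s.
have [cr _] := cadlag_cst c s.
split; last exists (x, c).
- by apply: cvg_pair => //; exact: cr.
- apply: cvg_pair => //.
  by move=> U /nbhs_singleton Uc; apply: nearW.
Qed.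

End cadlag_paths.
Arguments cylinders {R I} S.

Section half_line.
Context {R : realType}.

Definition half_line : set R := [set` `[0, +oo[].

Lemma time_subproof (x : R) : Num.max 0 x \in half_line.
Proof. by rewrite inE /half_line /= in_itv /= le_max lexx. Qed.

(* Nonnegative reals as elements of half_line; only used for 0 <= x. *)
Definition time (x : R) : half_line := exist _ (Num.max 0 x) (time_subproof x).

Lemma val_time (x : R) : 0 <= x -> sval (time x) = x.
Proof. by move=> x0; rewrite /=; apply/max_idPr. Qed.

Lemma half_line_ge0 (s : half_line) : 0 <= sval s.
Proof. by have := valP s; rewrite inE /half_line /= in_itv /= andbT. Qed.

Lemma time_val (s : half_line) : time (sval s) = s.
Proof. by apply: val_inj; apply: val_time; exact: half_line_ge0. Qed.

(* h(s-), for 0 < s *)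
Definition left_lim (S : ptopologicalType) (h : cadlag_path half_line S)
    (s : R) : S :=
  lim (h @ left_of (time s)).

Context {S : topologicalType}.

(* h = concatenation of the paths z_0, z_1, .., z_n, z_i being started at a_i *)
Lemma cadlag_concat (I : set R) (n : nat) (a : nat -> R)
    (z : nat -> half_line -> S) (h : I -> S) :
  a 0%N = 0 -> (forall i, a i < a i.+1) -> (forall s : I, 0 <= sval s) ->
  (forall i, cadlag (z i)) ->
  (forall (s : I) i, (i <= n)%N -> a i <= sval s ->
    (i < n)%N ==> (sval s < a i.+1) -> h s = z i (time (sval s - a i))) ->
  cadlag h.
Proof.
move=> a0 ai I0 zc hz s.
have [i [lein ais sai]] : exists i, [/\ (i <= n)%N, a i <= sval s &
    (i < n)%N ==> (sval s < a i.+1)].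
  have : forall m, (m <= n)%N -> a m <= sval s \/ exists i, [/\ (i <= n)%N,
      a i <= sval s & (i < n)%N ==> (sval s < a i.+1)].
    elim=> [_|m IHm mn]; first by left; rewrite a0.
    have [ams|] := IHm (ltnW mn); last by right.
    have [|sam] := leP (a m.+1) (sval s); first by left.
    by right; exists m; rewrite ltnW// ams sam implybT.
  move=> /(_ n (leqnn n))[ans|//].
  by exists n; rewrite leqnn ltnn.
have zr := (zc i (time (sval s - a i))).1.
split.
  apply/cvg_right_ofP => U; rewrite (hz s i)// => Us.
  have [e e0 eU] := (cvg_right_ofP _ _ _).1 zr U Us.
  have [d d0 dn] : exists2 d, 0 < d & forall x : I, sval x < sval s + d ->
      (i < n)%N ==> (sval x < a i.+1).
    move: sai; case: ltnP => //= _; last by exists 1.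
    by move=> sai; exists (a i.+1 - sval s) => [|x]; lra.
  exists (Num.min e d) => [|x sx]; first by rewrite lt_min e0.
  rewrite -ltrBlDl lt_min => /andP[xe xd].
  rewrite (hz x i)//; [|lra|by apply: dn; lra].
  apply: eU; rewrite !val_time; lra.
have [sai'|ais'] := ltP (a i) (sval s).
  have [y zl] := (zc i (time (sval s - a i))).2.
  exists y; apply/cvg_left_ofP => U Uy.
  have [e e0 eU] := (cvg_left_ofP _ _ _).1 zl U Uy.
  exists (Num.min e (sval s - a i)) => [|x]; first by rewrite lt_min; lra.
  rewrite ltrBlDl -ltrBlDr lt_min => /andP[xe xd] xs.
  rewrite (hz x i)//; [|lra|].
    apply: eU; rewrite !val_time; lra.
  by move: sai; case: ltnP => //= _ ?; lra.
have {ais' ais}sE : sval s = a i by apply/eqP; rewrite eq_le ais ais'.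
case: i => [|i] in lein sai zr sE *.
  exists (h s); apply/cvg_left_ofP => U _; exists 1 => // x _.
  by rewrite sE a0 ltNge I0.
have [y zl] := (zc i (time (sval s - a i))).2.
exists y; apply/cvg_left_ofP => U Uy.
have [e e0 eU] := (cvg_left_ofP _ _ _).1 zl U Uy.
have aii := ai i.
exists (Num.min e (sval s - a i)) => [|x]; first by rewrite lt_min; lra.
rewrite ltrBlDl -ltrBlDr lt_min => /andP[xe xd] xs.
rewrite (hz x i)//; [|exact: ltnW|lra|].
  apply: eU; rewrite !val_time; lra.
by apply/implyP => _; lra.
Qed.

Lemma cadlag_shift (T : R) (h : cadlag_path half_line S) :
  0 <= T -> cadlag (fun s : half_line => h (time (T + sval s))).
Proof.
move=> T0 s; have s0 := half_line_ge0 s.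
have [hr [x hl]] := cadlagP h (time (T + sval s)).
split; last exists x.
  apply/cvg_right_ofP => U Us.
  have [e e0 eU] := (cvg_right_ofP _ _ _).1 hr U Us.
  exists e => // y sy ys; have y0 := half_line_ge0 y.
  by apply: eU; rewrite !val_time; lra.
apply/cvg_left_ofP => U Us.
have [e e0 eU] := (cvg_left_ofP _ _ _).1 hl U Us.
exists e => // y sy ys; have y0 := half_line_ge0 y.
by apply: eU; rewrite !val_time; lra.
Qed.

Lemma max0_ge0 (T : R) : 0 <= Num.max 0 T.
Proof. by rewrite le_max lexx. Qed.

(* The path s |-> h (T + s); only used for 0 <= T. *)
Definition shift_path (T : R) (h : cadlag_path half_line S) :
    cadlag_path half_line S :=
  CadlagPath (cadlag_shift h (max0_ge0 T)).

End half_line.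
Arguments half_line R : clear implicits.


Section markov.
Context {R : realType} {E : ptopologicalType}.
Local Notation D := (cadlag_path (half_line R) E).

Definition filtration (t : R) : set (set D) :=
  <<s \bigcup_(s in [set s : half_line R | sval s <= t])
        preimage_set_system [set: D] (fun h : D => h s)
          (@measurable _ (borel E)) >>.

Definition stopping_time (T : D -> \bar R) : Prop :=
  (forall h, 0 <= T h)%E /\
  forall t : R, 0 <= t -> filtration t [set h | (T h <= t%:E)%E].

Definition stopped_events (T : D -> \bar R) : set (set D) :=
  [set A | measurable A /\
    forall t : R, 0 <= t -> filtration t (A `&` [set h | (T h <= t%:E)%E])].

(* Q x is the law of the process started from x; a process with initial law mu
   has law \int[mu]_x Q x. *)
Definition strong_markov (Q : R.-pker (borel E) ~> D) : Prop :=
  (forall x : E, Q x [set h : D | h (time 0) = x] = 1%E) /\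
  forall T : D -> \bar R, stopping_time T ->
  forall A : set D, stopped_events T A ->
  forall B : set D, measurable B -> forall x : E,
    Q x (A `&` [set h | (T h < +oo)%E /\ B (shift_path (fine (T h)) h)]) =
    (\int[Q x]_(h in A `&` [set h | (T h < +oo)%E])
      Q (h (time (fine (T h)))) B)%E.

End markov.

Section families.
Context d d' (Om : measurableType d) (T : measurableType d') (R : realType).
Context (P : probability Om R).

(* Generators of the sigma-algebra of the variables X i, for i in J. *)
Definition events (I : Type) (J : set I) (X : I -> Om -> T) : set (set Om) :=
  \bigcup_(i in J) preimage_set_system [set: Om] (X i) measurable.

Definition mutually_independent (I : eqType) (X : I -> Om -> T) : Prop :=
  forall (s : seq I) (B : I -> set T), uniq s ->
    (forall i, measurable (B i)) ->
    P [set w | forall i, i \in s -> B i (X i w)] =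
    (\prod_(i <- s) P (X i @^-1` B i))%E.

Definition iid (I : eqType) (X : I -> Om -> T) (law : set T -> \bar R) : Prop :=
  [/\ forall i, measurable_fun [set: Om] (X i),
      forall i (B : set T), measurable B -> P (X i @^-1` B) = law B &
      mutually_independent X].

End families.

Definition independent_sigma d (Om : measurableType d) (R : realType)
    (P : probability Om R) (G1 G2 : set (set Om)) : Prop :=
  forall A B : set Om, <<s G1 >> A -> <<s G2 >> B ->
    P (A `&` B) = (P A * P B)%E.

Section offspring.
Context {R : realType} (p : probability nat R).

Definition mean : R := fine (\int[p]_k k%:R%:E)%E.

Definition second_moment : \bar R := (\int[p]_k (k ^ 2)%:R%:E)%E.

End offspring.

Definition label := {k : nat | (0 < k)%N}.
Definition word := seq label.

Definition strict_prefixes (u : word) : seq word :=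
  [seq take i u | i <- iota 0 (size u)].
Definition prefixes (u : word) : seq word :=
  [seq take i u | i <- iota 0 (size u).+1].

Definition tree (nu : word -> nat) : set word :=
  [set u | forall (v : word) (j : label),
    prefix (rcons v j) u -> (val j <= nu v)%N].

Section genealogy.
Context {R : realType} (l : word -> R).

Definition birth (u : word) : R := \sum_(v <- strict_prefixes u) l v.
Definition death (u : word) : R := birth u + l u.

Definition alive (nu : word -> nat) (t : R) : set word :=
  [set u | tree nu u /\ birth u <= t < death u].

(* u(t); defaults to u when death u <= t, where u(t) is not defined. *)
Definition ancestor (u : word) (t : R) : word :=
  nth u (prefixes u)
    (find (fun v => birth v <= t < death v) (prefixes u)).

Definition lineage_log (nu : word -> nat) (u : word) (t : R) : R :=
  \sum_(v <- strict_prefixes (ancestor u t)) ln (nu v)%:R.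

Lemma birth_take (u : word) (i : nat) : (i <= size u)%N ->
  birth (take i u) = \sum_(j < i) l (take j u).
Proof.
move=> iu; rewrite /birth /strict_prefixes big_map size_takel//.
rewrite -[i in iota _ i]subn0 big_mkord; apply: eq_bigr => j _.
by rewrite take_takel// ltnW.
Qed.

Lemma death_take (u : word) (i : nat) : (i <= size u)%N ->
  death (take i u) = \sum_(j < i.+1) l (take j u).
Proof. by move=> iu; rewrite /death birth_take// big_ord_recr. Qed.

Lemma ancestor_take (u : word) (t : R) (i : nat) :
  (forall v, 0 < l v) -> (i <= size u)%N ->
  \sum_(j < i) l (take j u) <= t ->
  (i < size u)%N ==> (t < \sum_(j < i.+1) l (take j u)) ->
  ancestor u t = take i u.
Proof.
move=> l0 iu it ti; rewrite /ancestor.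
set P := fun v => _.
pose a i := \sum_(j < i) l (take j u).
have le_a : {homo a : m n / (m <= n)%N >-> m <= n}.
  apply: homo_leq => [//|x y z|k]; first exact: le_trans.
  by rewrite /a big_ord_recr /= lerDl ltW.
have sP : size (prefixes u) = (size u).+1 by rewrite size_map size_iota.
have nthP j : (j <= size u)%N -> nth u (prefixes u) j = take j u.
  by move=> ju; rewrite (nth_map 0%N) ?size_iota// nth_iota.
have [hP|hP] := boolP (has P (prefixes u)).
  have := nth_find u hP; have := hP; rewrite has_find sP ltnS.
  set k := find _ _ => ku; rewrite nthP// /P birth_take// death_take//.
  move=> /andP[]; rewrite -![\sum_(j < _) _]/(a _) => kt tk.
  rewrite -/(a i) in it; rewrite -/(a i.+1) in ti.
  congr take; apply/eqP; rewrite eqn_leq; apply/andP; split.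
    rewrite leqNgt; apply/negP => ik.
    have := lt_le_trans (implyP ti (leq_trans ik ku)) (le_a _ _ ik).
    by rewrite ltNge kt.
  rewrite leqNgt; apply/negP => ki.
  by have := lt_le_trans tk (le_a _ _ ki); rewrite ltNge it.
rewrite nth_default ?hasNfind//.
move: iu ti; rewrite leq_eqVlt => /predU1P[-> _|iu /implyP/(_ iu) ti].
  by rewrite take_size.
case/negP: hP; apply/hasP; exists (take i u).
  by apply/mapP; exists i; rewrite // mem_iota add0n ltnS (ltnW iu).
by rewrite /P (birth_take (ltnW iu)) (death_take (ltnW iu)) it ti.
Qed.

End genealogy.

Section branching.
Context d (Om : measurableType d) {R : realType} (E : ptopologicalType).
Local Notation D := (cadlag_path (half_line R) E).

(* theta u is the uniform variable used at the death of u.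
   motion u is a trajectory of X run on the whole of [0, +oo), of which u
   follows the part before its death: the position of u at time birth u + s is
   motion u s for s < life u. *)
Record branching_data := BranchingData {
  offspring : word -> Om -> nat;
  life : word -> Om -> R;
  theta : word -> Om -> R;
  motion : word -> Om -> D;
  life_gt0 : forall u w, 0 < life u w;
  theta_itv : forall u w, 0 <= theta u w <= 1 }.

Variable X : branching_data.

Definition alive_at (t : R) (w : Om) : set word :=
  alive (life X ^~ w) (offspring X ^~ w) t.

Definition position (u : word) (w : Om) (t : R) : E * R :=
  let v := ancestor (life X ^~ w) u t in
  (motion X v w (time (t - birth (life X ^~ w) v)),
   lineage_log (life X ^~ w) (offspring X ^~ w) u t).

Lemma cadlag_position (u : word) (w : Om) (t : R) :
  cadlag (fun s : [set` `[0, t]] => position u w (sval s)).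
Proof.
pose l := life X ^~ w; pose nu := offspring X ^~ w.
pose z i := cadlag_pair (motion X (take i u) w)
  (\sum_(v <- strict_prefixes (take i u)) ln (nu v)%:R : R).
apply: (@cadlag_concat _ _ _ (size u) (fun i => \sum_(j < i) l (take j u))
  (fun i s => (motion X (take i u) w s,
    \sum_(v <- strict_prefixes (take i u)) ln (nu v)%:R : R))).
- by rewrite big_ord0.
- by move=> i; rewrite big_ord_recr /= ltrDl; exact: life_gt0.
- by move=> s; have := valP s; rewrite inE /= in_itv /= => /andP[].
- exact: z.
- move=> s i iu ais sai; rewrite /position /lineage_log.
  have l0 v : 0 < l v by exact: life_gt0.
  by rewrite (ancestor_take l0 iu ais sai) birth_take.
Qed.

(* The path of (X^u, Lambda^u) on [0, t]. *)
Definition lineage (u : word) (t : R) (w : Om) :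
    cadlag_path [set` `[0, t]] (E * R)%type :=
  CadlagPath (@cadlag_position u w t).

Variables (F : nat -> nat -> E * R -> E) (Q : R.-pker (borel E) ~> D).
Variable mu : probability (borel E) R.

Definition parent (u : word) : word := take (size u).-1 u.
Definition birth_rank (u : word) : nat := last 0%N [seq val j | j <- u].

(* For u <> [::], F^(k)_j at the left limit of the parent's path at its death. *)
Definition initial_position (u : word) (w : Om) : E :=
  let v := parent u in
  F (offspring X v w) (birth_rank u)
    (left_lim (motion X v w) (life X v w), theta X v w).

Definition motion_law (u : word) (w : Om) (B : set D) : \bar R :=
  if u == [::] then (\int[mu]_x Q x B)%E else Q (initial_position u w) B.

(* The tree and the trajectories of the generations before the n-th. *)
Definition history (n : nat) : set (set Om) :=
  <<s events [set: word] (offspring X) `|` events [set: word] (life X) `|`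
      events [set v | (size v < n)%N] (motion X) `|`
      events [set v | (size v < n)%N] (theta X) >>.

Record branching_process (P : probability Om R) (r : R) (p : probability nat R)
    : Prop := {
  offspring_iid : iid P (offspring X) p;
  life_iid : iid P (life X) (exponential_prob r);
  offspring_life_independent : independent_sigma P
    (events [set: word] (offspring X)) (events [set: word] (life X));
  measurable_motion : forall u, measurable_fun [set: Om] (motion X u);
  measurable_theta : forall u, measurable_fun [set: Om] (theta X u);
  (* Given the tree and the past, the particles of generation n move
     independently according to X, and the theta's are independent uniform. *)
  branching : forall (n : nat) (s : seq word), uniq s ->
    all (fun u => size u == n) s ->
    forall (G : set Om), history n G ->
    forall (B : word -> set D) (C : word -> set R),
    (forall u, measurable (B u)) -> (forall u, measurable (C u)) ->
    let inT := [set w | forall u, u \in s -> tree (offspring X ^~ w) u] in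
    P (G `&` inT `&` [set w | forall u, u \in s ->
        B u (motion X u w) /\ C u (theta X u w)]) =
    (\int[P]_(w in G `&` inT)
       \prod_(u <- s) (motion_law u w (B u) * uniform_prob (@ltr01 R) (C u)))%E
}.

End branching.

(* A counting process with unit jumps; jump N k is its k-th jump time, and
   holding N k = jump N k.+1 - jump N k, with jump N 0 = 0. *)
Record counting_process (Om : Type) (R : realType) := CountingProcess {
  jump_count : R -> Om -> nat;
  holding : nat -> Om -> R;
  holding_gt0 : forall k w, 0 < holding k w;
  countP : forall t w k, 0 <= t ->
    (k <= jump_count t w)%N = (\sum_(i < k) holding i w <= t) }.

Definition jump (Om : Type) (R : realType) (N : counting_process Om R)
    (k : nat) (w : Om) : R := \sum_(i < k) holding N i w.

(* Jump chain/holding time definition of the Poisson process. *)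
Definition poisson_process d (Om : measurableType d) (R : realType)
    (P : probability Om R) (lambda : R) (N : counting_process Om R) : Prop :=
  iid P (holding N) (exponential_prob lambda).

Section auxiliary.
Context d (Om : measurableType d) {R : realType} (E : ptopologicalType).
Local Notation D := (cadlag_path (half_line R) E).

(* mark k, child_index k and aux_theta k stand for H_(k+1), I_(k+1) and
   Theta_(k+1);
   Y follows the trajectory aux_motion k on [jump k, jump k.+1). *)
Record auxiliary_data := AuxiliaryData {
  jumps : counting_process Om R;
  mark : nat -> Om -> nat;
  child_index : nat -> Om -> nat;
  aux_theta : nat -> Om -> R;
  aux_motion : nat -> Om -> D;
  index_itv : forall k w, (0 < child_index k w <= mark k w)%N;
  aux_theta_itv : forall k w, 0 <= aux_theta k w <= 1 }.

Variable Y : auxiliary_data.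

Definition aux_position (w : Om) (t : R) : E * R :=
  let n := jump_count (jumps Y) t w in
  (aux_motion Y n w (time (t - jump (jumps Y) n w)),
   \sum_(k < n) ln (mark Y k w)%:R).

Lemma cadlag_aux_position (w : Om) (t : R) :
  cadlag (fun s : [set` `[0, t]] => aux_position w (sval s)).
Proof.
pose z i := cadlag_pair (aux_motion Y i w)
  (\sum_(k < i) ln (mark Y k w)%:R : R).
have I0 (s : [set` `[0, t]]) : 0 <= sval s <= t.
  by have := valP s; rewrite inE /= in_itv.
apply: (@cadlag_concat _ _ _ (jump_count (jumps Y) t w)
  (fun i => jump (jumps Y) i w)
  (fun i s => (aux_motion Y i w s, \sum_(k < i) ln (mark Y k w)%:R : R))).
- by rewrite /jump big_ord0.
- by move=> i; rewrite /jump big_ord_recr /= ltrDl; exact: holding_gt0.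
- by move=> s; have /andP[] := I0 s.
- exact: z.
- move=> s i it ais sai; have /andP[s0 st] := I0 s.
  rewrite /aux_position; suff -> : jump_count (jumps Y) (sval s) w = i by [].
  apply/eqP; rewrite eqn_leq (countP _ _ i s0) ais andbT.
  rewrite leqNgt; apply/negP => si.
  have iN : (i < jump_count (jumps Y) t w)%N.
    rewrite countP ?(le_trans s0)//; apply: le_trans st.
    by rewrite -countP.
  move: sai; rewrite iN /= ltNge => /negP; apply.
  by rewrite /jump -countP.
Qed.

Definition aux_path (t : R) (w : Om) :
    cadlag_path [set` `[0, t]] (E * R)%type :=
  CadlagPath (@cadlag_aux_position w t).

Variables (F : nat -> nat -> E * R -> E) (Q : R.-pker (borel E) ~> D).
Variable mu : probability (borel E) R.

Definition aux_motion_law (n : nat) (w : Om) (B : set D) : \bar R :=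
  if n is k.+1 then
    Q (F (mark Y k w) (child_index Y k w)
        (left_lim (aux_motion Y k w) (holding (jumps Y) k w),
         aux_theta Y k w)) B
  else (\int[mu]_x Q x B)%E.

Definition jump_events : set (set Om) :=
  events [set t : R | 0 <= t] (jump_count (jumps Y)).
Definition mark_events : set (set Om) := events [set: nat] (mark Y).

Definition aux_history (n : nat) : set (set Om) :=
  <<s jump_events `|` mark_events `|` events [set: nat] (child_index Y) `|`
      events [set k | (k < n)%N] (aux_motion Y) `|`
      events [set k | (k < n)%N] (aux_theta Y) >>.

Record auxiliary_process (P : probability Om R) (r : R) (p : probability nat R)
    : Prop := {
  jumps_poisson : poisson_process P (r * mean p) (jumps Y);
  measurable_mark : forall k, measurable_fun [set: Om] (mark Y k);
  mark_law : forall k h : nat, P (mark Y k @^-1` [set h]) =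
    (h%:R%:E * p [set h] / (mean p)%:E)%E;
  mark_independent : mutually_independent P (mark Y);
  mark_jumps_independent : independent_sigma P mark_events jump_events;
  measurable_index : forall k, measurable_fun [set: Om] (child_index Y k);
  index_uniform : forall (n : nat) (i : nat -> nat) (G : set Om),
    <<s jump_events `|` mark_events >> G ->
    P (G `&` [set w | forall k, (k < n)%N -> child_index Y k w = i k]) =
    (\int[P]_(w in G) (\prod_(k < n)
       (if (0 < i k <= mark Y k w)%N then (mark Y k w)%:R^-1 else 0))%:E)%E;
  measurable_aux_motion : forall k, measurable_fun [set: Om] (aux_motion Y k);
  measurable_aux_theta : forall k, measurable_fun [set: Om] (aux_theta Y k);
  aux_evolution : forall (n : nat) (G : set Om), aux_history n G ->
    forall (B : set D) (C : set R), measurable B -> measurable C ->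
    P (G `&` [set w | B (aux_motion Y n w) /\ C (aux_theta Y n w)]) =
    (\int[P]_(w in G)
       (aux_motion_law n w B * uniform_prob (@ltr01 R) C))%E
}.

End auxiliary.

(* Main.v *)
(* Decompose both sides according to the spine: on the left, the word u of
   generation n alive at time t and the offspring numbers h_0, ..., h_(n-1) of
   its strict ancestors; on the right, the ranks I_k and marks H_k of the jumps
   before t. For a fixed spine, the lifetimes x_0, ..., x_(n-1) have density
   r^n e^(-r t) on [x_0 + ... + x_(n-1) <= t] on the left and
   (r m)^n e^(-r m t) on the right, because the factor e^(-a (t - sum x_i))
   coming from the last, unfinished, lifetime completes the exponential density
   to a constant; the spine has weight prod p(h_i) on the left and
   prod (h_i p(h_i) / m) (1 / h_i) on the right. The ratio is e^(r (m - 1) t),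
   whatever the spine. Given the lifetimes and the spine, motions and thetas are
   drawn from the same kernels on both sides, hence the laws of the paths on
   [0, t] have this same ratio, by induction on the generation and
   uniqueness of measures on boxes. Summing over spines gives the many-to-one
   formula with the factor e^(r (m - 1) t), which is E[N_t] as the case f = 1
   shows. *)

Require Import Defs.
From HB Require Import structures.
From mathcomp Require Import finmap.
From mathcomp Require Import all_boot all_order all_algebra.
From mathcomp Require Import all_classical all_reals all_analysis.
From mathcomp Require Import measurable_realfun.
From mathcomp Require Import ring lra.
Import Order.TTheory GRing.Theory Num.Theory.
Import numFieldNormedType.Exports.

Set Implicit Arguments.
Unset Strict Implicit.
Unset Printing Implicit Defensive.

Local Open Scope classical_set_scope.
Local Open Scope ring_scope.

(** * Sequences *)

(** An alias of [nat -> T] that can carry the product sigma-algebra. Tuples of every length are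
    encoded in this one type, so inductions on the generation never change the ambient space. *)
Definition infseq (T : Type) := nat -> T.

Definition set_coordinate (T : Type) (k : nat) (z : infseq T) (y : T) :
    infseq T :=
  fun i => if i == k then y else z i.

Definition rectangle (T : Type) (B : nat -> set T) : set (infseq T) :=
  [set z | forall i, B i (z i)].

Section infseq_measurable.
Context d (T : measurableType d).

HB.instance Definition _ := Pointed.copy (infseq T) (nat -> T).

Definition coordinate_events : set (set (infseq T)) :=
  \bigcup_(i in [set: nat])
    preimage_set_system [set: infseq T] (fun z => z i) measurable.

HB.instance Definition _ :=
  @isMeasurable.Build (sigma_display coordinate_events) (infseq T)
    <<s coordinate_events >> (@sigma_algebra0 _ setT coordinate_events)
    (@sigma_algebraC (infseq T) coordinate_events)
    (@sigma_algebra_bigcup _ setT coordinate_events).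

Lemma measurable_coordinate (i : nat) :
  measurable_fun [set: infseq T] (fun z : infseq T => z i).
Proof. by move=> _ A mA; apply: sub_sigma_algebra; exists i => //; exists A. Qed.

Lemma measurable_fun_infseq d' (U : measurableType d')
    (g : U -> infseq T) :
  (forall i, measurable_fun [set: U] (fun w => g w i)) ->
  measurable_fun [set: U] g.
Proof.
move=> mg; apply: (measurability coordinate_events) => //.
by move=> _ [_ [i _ [B mB <-]] <-] /=; rewrite setTI; exact: mg.
Qed.

Lemma measurable_set_coordinate (k : nat) :
  measurable_fun [set: infseq T * T]
    (fun zy => set_coordinate k zy.1 zy.2).
Proof.
apply: measurable_fun_infseq => i; rewrite /set_coordinate.
case: eqP => _; first exact: measurable_snd.
exact: (measurableT_comp (measurable_coordinate i) measurable_fst).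
Qed.

Lemma measurable_rectangle (B : nat -> set T) :
  (forall i, measurable (B i)) -> measurable (rectangle B).
Proof.
move=> mB.
have -> : rectangle B = \bigcap_(i in setT) ((fun z => z i) @^-1` B i).
  by apply/seteqP; split=> [z zB i _|z zB i]; exact: zB.
apply: bigcapT_measurable => i; rewrite -[X in measurable X]setTI.
exact: measurable_coordinate.
Qed.

(** Rectangles with measurable sides are stable under intersection, and they generate the
    sigma-algebra because a one-coordinate cylinder is a rectangle whose other sides are full.
    Finite total mass then gives uniqueness. *)
Lemma infseq_measure_unique (R : realType)
    (m1 m2 : {measure set (infseq T) -> \bar R}) :
  (m1 setT < +oo)%E ->
  (forall B : nat -> set T, (forall i, measurable (B i)) ->
    m1 (rectangle B) = m2 (rectangle B)) ->
  forall A, measurable A -> m1 A = m2 A.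
Proof.
move=> m1oo m12 A mA.
pose C := [set rectangle B |
  B in [set B : nat -> set T | forall i, measurable (B i)]].
have CT : C setT.
  exists (fun=> setT) => //=; apply/seteqP; split=> [//|z _ i].
  exact: I.
apply: (measure_unique C (fun=> setT)) => //.
- apply/seteqP; split.
    apply: smallest_sub; first exact: smallest_sigma_algebra.
    move=> _ [i _ [B mB <-]]; apply: sub_sigma_algebra.
    exists (fun j => if j == i then B else setT) => [j /=|]; first by case: eqP.
    apply/seteqP; split=> [z /(_ i)|z [_ zB] j]; first by rewrite eqxx.
    by case: eqP => // ->.
  apply: smallest_sub; first exact: sigma_algebra_measurable.
  by move=> _ [B mB <-]; exact: measurable_rectangle.
- move=> _ _ [B mB <-] [B' mB' <-]; exists (fun i => B i `&` B' i) => [i|].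
    exact: measurableI.
  apply/seteqP; split=> [z zB|z [zB zB'] i]; last by split.
  by split=> i; have [] := zB i.
- by rewrite bigcup_const.
- by move=> _ [B mB <-]; exact: m12.
Qed.

End infseq_measurable.

(** * Integration against laws *)

Section density.
Context d (T : measurableType d) (R : realType).
Variables (m m' : {measure set T -> \bar R}) (phi : T -> R).
Hypotheses (mphi : measurable_fun [set: T] phi) (phi0 : forall x, 0 <= phi x).
Hypothesis m'E : forall A, measurable A -> m' A = (\int[m]_(x in A) (phi x)%:E)%E.
Local Open Scope ereal_scope.
Import HBNNSimple.

Let density_nnsfun (g : {nnsfun T >-> R}) :
  \int[m']_x (g x)%:E = \int[m]_x ((g x)%:E * (phi x)%:E).
Proof.
have mg (r : R) : measurable (g @^-1` [set r]) by [].
rewrite integral_nnsfun//= patch_setT sintegralE.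
under eq_fsbigr do rewrite m'E//.
transitivity (\sum_(r \in range g)
    \int[m]_x (r%:E * (phi x * \1_(g @^-1` [set r]) x)%:E)).
  apply: eq_fsbigr => r; rewrite inE => -[w _ <-].
  rewrite ge0_integralZl_EFin//; last 2 first.
  - by move=> x _; rewrite lee_fin mulr_ge0.
  - by apply/measurable_EFinP/measurable_funM.
  congr (_ * _); rewrite integral_mkcond epatch_indic.
  by apply: eq_integral => x _ /=; rewrite EFinM.
rewrite -ge0_integral_fsum//.
- apply: eq_integral => x _; rewrite -EFinM fsumEFin// [in RHS]fimfunE.
  congr EFin; rewrite mulr_fsuml; apply: eq_fsbigr => r _.
  by rewrite mulrCA mulrC.
- move=> r; apply/measurable_EFinP/measurable_funM => //.
  exact: measurable_funM.
- move=> r x _; have /= := nnfun_muleindic_ge0 g r x.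
  by rewrite -!EFinM mulrCA !lee_fin => rg; exact: mulr_ge0.
Qed.

(** The hypothesis on [m'] is the case of indicators; [density_nnsfun] extends it to simple
    functions by linearity, and monotone convergence along [nnsfun_approx] does the rest. *)
Lemma ge0_integral_density (g : T -> \bar R) :
  measurable_fun [set: T] g -> (forall x, 0 <= g x) ->
  \int[m']_x g x = \int[m]_x (g x * (phi x)%:E).
Proof.
move=> mg g0; pose g_ := nnsfun_approx measurableT mg.
have g_g x : EFin \o g_ ^~ x @ \oo --> g x.
  by apply: cvg_nnsfun_approx => // *; exact: g0.
have nd_g x : {homo g_ ^~ x : a b / (a <= b)%N >-> (a <= b)%R}.
  by move=> a b ab; exact/lefP/nd_nnsfun_approx.
transitivity (limn (fun n => \int[m']_x (g_ n x)%:E)).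
  rewrite -monotone_convergence//.
  - by apply: eq_integral => x _; apply/esym/cvg_lim => //; exact: g_g.
  - by move=> n; exact/measurable_EFinP.
  - by move=> n x _; rewrite lee_fin.
  - by move=> x _ a b ab; rewrite lee_fin nd_g.
under eq_fun do rewrite density_nnsfun.
rewrite -monotone_convergence//.
- apply: eq_integral => x _; apply/cvg_lim => //.
  by apply: cvgeZr => //; exact: g_g.
- by move=> n; apply: emeasurable_funM; exact/measurable_EFinP.
- by move=> n x _; rewrite mule_ge0// lee_fin.
- by move=> x _ a b ab; rewrite lee_wpmul2r ?lee_fin// nd_g.
Qed.

End density.

(** Left unnormalised, with total mass [P G], so that events of probability zero need no separate
    treatment. *)
Definition law_on d e (Om : measurableType d) (T : measurableType e)
    (R : realType) (P : probability Om R) (G : set Om) (mG : measurable G)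
    (X : Om -> T) (mX : measurable_fun setT X) : {measure set T -> \bar R}.
Proof. by refine (pushforward (mrestr P mG) X). Defined.

Lemma law_onE d e (Om : measurableType d) (T : measurableType e)
    (R : realType) (P : probability Om R) (G : set Om) (mG : measurable G)
    (X : Om -> T) (mX : measurable_fun setT X) (A : set T) :
  law_on P mG mX A = P (G `&` X @^-1` A).
Proof. by rewrite setIC. Qed.

Lemma law_on_lty d e (Om : measurableType d) (T : measurableType e)
    (R : realType) (P : probability Om R) (G : set Om) (mG : measurable G)
    (X : Om -> T) (mX : measurable_fun setT X) :
  (law_on P mG mX setT < +oo)%E.
Proof.
rewrite law_onE preimage_setT setIT.
by rewrite (le_lt_trans (probability_le1 P mG))// ltry.
Qed.

(** The restriction of [P] to [G] has density [\1_G] with respect to [P]; the rest is the change of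
    variables for a pushforward. *)
Lemma ge0_integral_law_on d e (Om : measurableType d) (T : measurableType e)
    (R : realType) (P : probability Om R) (G : set Om) (mG : measurable G)
    (X : Om -> T) (mX : measurable_fun setT X) (g : T -> \bar R) :
  measurable_fun [set: T] g -> (forall x, 0 <= g x)%E ->
  (\int[P]_(w in G) g (X w) = \int[law_on P mG mX]_x g x)%E.
Proof.
move=> mg g0.
rewrite (@ge0_integral_pushforward _ _ _ _ _ X mX (mrestr P mG) setT g)//.
rewrite preimage_setT.
rewrite (@ge0_integral_density _ _ _ P (mrestr P mG) \1_G)//=.
- by rewrite integral_mkcond epatch_indic.
- by move=> A mA; rewrite integral_indic// setIC.
- exact: measurableT_comp.
Qed.

(** * Comparison of laws on two probability spaces *)

Section proportional_laws.
Context d d' (Om : measurableType d) (Om' : measurableType d') (R : realType).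
Variables (P : probability Om R) (P' : probability Om' R).
Variables (G : set Om) (G' : set Om') (c : {nonneg R}).
Hypotheses (mG : measurable G) (mG' : measurable G').

Definition proportional_laws e (T : measurableType e) (X : Om -> T)
    (X' : Om' -> T) : Prop :=
  forall A, measurable A ->
    P (G `&` X @^-1` A) = (c%:num%:E * P' (G' `&` X' @^-1` A))%E.

(** Both sides are measures in the event, finite on the left, and boxes form a generating class
    stable under intersection. *)
Lemma proportional_laws_pair e1 e2 (T1 : measurableType e1)
    (T2 : measurableType e2) (X : Om -> T1) (X' : Om' -> T1)
    (Y : Om -> T2) (Y' : Om' -> T2) :
  measurable_fun setT X -> measurable_fun setT X' ->
  measurable_fun setT Y -> measurable_fun setT Y' ->
  (forall A B, measurable A -> measurable B ->
    P (G `&` X @^-1` A `&` Y @^-1` B) =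
    (c%:num%:E * P' (G' `&` X' @^-1` A `&` Y' @^-1` B))%E) ->
  proportional_laws (fun w => (X w, Y w)) (fun w => (X' w, Y' w)).
Proof.
move=> mX mX' mY mY' XY A mA.
pose m1 := law_on P mG (measurable_fun_pair mX mY).
pose m2 : {measure set (T1 * T2) -> \bar R} :=
  mscale c (law_on P' mG' (measurable_fun_pair mX' mY')).
have <- : m1 A = P (G `&` (fun w => (X w, Y w)) @^-1` A) by exact: law_onE.
have -> : m1 A = m2 A; last first.
  by congr (_ * _)%E; exact: law_onE.
apply: (measure_unique [set A `*` B | A in measurable & B in measurable]
  (fun=> setT)) => //.
- exact: measurable_prod_measurableType.
- move=> _ _ [A1 mA1 [B1 mB1 <-]] [A2 mA2 [B2 mB2 <-]].
  exists (A1 `&` A2); first exact: measurableI.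
  by exists (B1 `&` B2); [exact: measurableI|rewrite setXI].
- by move=> _; exists setT => //; exists setT => //; rewrite setXTT.
- by rewrite bigcup_const.
- move=> _ [A1 mA1 [B1 mB1 <-]].
  rewrite /m1 law_onE; have := XY _ _ mA1 mB1; rewrite -!setIA => ->.
  by congr (_ * _)%E; apply/esym; exact: law_onE.
- by move=> _; exact: (law_on_lty P mG (measurable_fun_pair mX mY)).
Qed.

Lemma proportional_laws_integral e (T : measurableType e) (X : Om -> T)
    (X' : Om' -> T) (g : T -> \bar R) :
  measurable_fun setT X -> measurable_fun setT X' ->
  proportional_laws X X' ->
  measurable_fun [set: T] g -> (forall x, 0 <= g x)%E ->
  (\int[P]_(w in G) g (X w) = c%:num%:E * \int[P']_(w in G') g (X' w))%E.
Proof.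
move=> mX mX' XX' mg g0.
rewrite (ge0_integral_law_on P mG mX)// (ge0_integral_law_on P' mG' mX')//.
rewrite -ge0_integral_mscale//.
apply: eq_measure_integral => A mA _; rewrite law_onE XX'//.
by congr (_ * _)%E; apply/esym; exact: law_onE.
Qed.

End proportional_laws.

(** Independence identifies the joint law with the product of the marginals; Tonelli then integrates
    the second variable first, its marginal being replaced by [law]. *)
Lemma ge0_integral_independent d e1 e2 (Om : measurableType d)
    (T1 : measurableType e1) (T2 : measurableType e2) (R : realType)
    (P : probability Om R) (X : Om -> T1) (Y : Om -> T2)
    (law : {measure set T2 -> \bar R}) (g : T1 * T2 -> \bar R) :
  measurable_fun setT X -> measurable_fun setT Y ->
  (forall B, measurable B -> P (Y @^-1` B) = law B) ->
  (forall A B, measurable A -> measurable B ->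
    P (X @^-1` A `&` Y @^-1` B) = (P (X @^-1` A) * P (Y @^-1` B))%E) ->
  measurable_fun [set: T1 * T2] g -> (forall z, 0 <= g z)%E ->
  (\int[P]_w g (X w, Y w) = \int[P]_w \int[law]_y g (X w, y))%E.
Proof.
move=> mX mY lawE XY mg g0.
have mXY := measurable_fun_pair mX mY.
pose mX' : {mfun Om >-> T1} := HB.pack X (isMeasurableFun.Build _ _ _ _ _ mX).
pose mY' : {mfun Om >-> T2} := HB.pack Y (isMeasurableFun.Build _ _ _ _ _ mY).
pose lX := distribution P mX'.
pose lY := distribution P mY'.
have prodE A : measurable A ->
    (lX \x lY)%E A = law_on P measurableT mXY A.
  apply: product_measure_unique => A1 B1 mA1 mB1.
  by rewrite law_onE setTI; exact: XY.
transitivity (\int[lX \x lY]_z g z)%E.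
  rewrite (@ge0_integral_law_on _ _ _ _ _ P _ measurableT _ mXY g)//.
  by apply: eq_measure_integral => A mA _; exact/esym/prodE.
rewrite fubini_tonelli1//.
have lawlY x : (\int[law]_y g (x, y) = \int[lY]_y g (x, y))%E.
  by apply: eq_measure_integral => A mA _; exact/esym/lawE.
under [RHS]eq_integral do rewrite lawlY.
rewrite (ge0_integral_pushforward mX)//.
- exact: (@measurable_fun_fubini_tonelli_F _ _ _ _ _ lY g).
- by move=> x _; exact: integral_ge0.
Qed.

(** * Exponential lifetimes *)

Definition truncated_sequence (Om : Type) (R : realType) (x : nat -> Om -> R)
    (n : nat) (w : Om) : infseq R :=
  fun i => if (i < n)%N then x i w else 0.

Lemma truncated_sequenceS (Om : Type) (R : realType) (x : nat -> Om -> R)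
    (n : nat) (w : Om) :
  truncated_sequence x n.+1 w =
  set_coordinate n (truncated_sequence x n w) (x n w).
Proof.
apply/funext => i; rewrite /truncated_sequence /set_coordinate ltnS leq_eqVlt.
by case: eqP => [->|].
Qed.

Lemma measurable_truncated_sequence d (Om : measurableType d) (R : realType)
    (x : nat -> Om -> R) (n : nat) :
  (forall i, measurable_fun [set: Om] (x i)) ->
  measurable_fun [set: Om] (truncated_sequence x n).
Proof.
move=> mx; apply: measurable_fun_infseq => i; rewrite /truncated_sequence.
by case: ltnP => _; [exact: mx|exact: measurable_cst].
Qed.

(* A point of R^n is encoded by a sequence that vanishes from index n on. *)
Fixpoint orthant_integral (R : realType) (n : nat) (g : infseq R -> \bar R) :
    \bar R :=
  if n is k.+1 then
    orthant_integral k (fun z =>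
      \int[lebesgue_measure]_(y in [set` `[0%R, +oo[]) g (set_coordinate k z y))%E
  else g (fun=> 0).

Definition exponential_measure (R : realType) (a : R) (a_gt0 : 0 < a) :
  {measure set (measurableTypeR R) -> \bar R}.
Proof. by refine (exponential_prob a). Defined.

Lemma ge0_integral_exponential (R : realType) (a : R) (a_gt0 : 0 < a)
    (g : R -> \bar R) :
  measurable_fun [set: R] g -> (forall x, 0 <= g x)%E ->
  (\int[exponential_measure a_gt0]_x g x =
   \int[lebesgue_measure]_x (g x * (exponential_pdf a x)%:E))%E.
Proof.
move=> mg g0; apply: ge0_integral_density => //.
- exact: measurable_exponential_pdf.
- by move=> x; apply: exponential_pdf_ge0; exact: ltW.
Qed.

Section exponential_variables.
Context d (Om : measurableType d) (R : realType) (P : probability Om R).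
Variables (a : R) (x : nat -> Om -> R) (n : nat).
Hypotheses (a_gt0 : 0 < a) (mx : forall i, measurable_fun [set: Om] (x i)).
Hypothesis x_gt0 : forall i w, 0 < x i w.
Hypothesis x_law : forall i (B : set R), measurable B ->
  P (x i @^-1` B) = exponential_prob a B.
Hypothesis x_indep : forall (k : nat) (B : nat -> set R), (k <= n.+1)%N ->
  (forall i, measurable (B i)) ->
  P [set w | forall i, (i < k)%N -> B i (x i w)] =
  (\prod_(i < k) P (x i @^-1` B i))%E.

Let mpre (i : nat) (B : set R) : measurable B -> measurable (x i @^-1` B).
Proof. by move=> mB; rewrite -[X in measurable X]setTI; exact: mx. Qed.

Let mtr (k : nat) (A : set (infseq R)) : measurable A ->
  measurable (truncated_sequence x k @^-1` A).
Proof.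
move=> mA; rewrite -[X in measurable X]setTI.
exact: (measurable_truncated_sequence k mx).
Qed.

(** As functions of [A], both sides are finite measures on sequences, so [infseq_measure_unique]
    reduces the claim to rectangles, where [x_indep] applies. *)
Lemma truncated_sequence_independent (k : nat) (A : set (infseq R))
    (B : set R) : (k <= n)%N -> measurable A -> measurable B ->
  P (truncated_sequence x k @^-1` A `&` x k @^-1` B) =
  (P (truncated_sequence x k @^-1` A) * P (x k @^-1` B))%E.
Proof.
move=> kn mA mB.
have mtk := measurable_truncated_sequence k mx.
have PB0 : 0 <= fine (P (x k @^-1` B)) by exact: fine_ge0.
pose c := NngNum PB0.
have cE : c%:num%:E = P (x k @^-1` B).
  by rewrite /= fineK// fin_num_measure//; exact: mpre.
pose m1 := law_on P (mpre k mB) mtk.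
pose m2 : {measure set (infseq R) -> \bar R} :=
  mscale c (law_on P measurableT mtk).
have m1E A' : m1 A' = P (truncated_sequence x k @^-1` A' `&` x k @^-1` B).
  by rewrite setIC; exact: law_onE.
have m2E A' : m2 A' =
    (P (truncated_sequence x k @^-1` A') * P (x k @^-1` B))%E.
  rewrite muleC -cE; congr (_ * _)%E.
  by have := law_onE P measurableT mtk A'; rewrite setTI.
rewrite -m1E -m2E; apply: infseq_measure_unique => // [|A' mA'].
  exact: (law_on_lty P (mpre k mB) mtk).
rewrite m1E m2E.
(* The coordinates from [k] on are constantly 0: a rectangle with such a side missing 0 has an empty
   preimage, and otherwise these sides impose nothing. *)
have [A'0|/existsNP[i /not_implyP[ki A'i]]] :=
    pselect (forall i, (k <= i)%N -> A' i 0); last first.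
  suff -> : truncated_sequence x k @^-1` rectangle A' = set0.
    by rewrite set0I measure0 mul0e.
  rewrite -subset0 => w /(_ i); rewrite /truncated_sequence ltnNge ki /=.
  exact: A'i.
have trE : truncated_sequence x k @^-1` rectangle A' =
    [set w | forall i, (i < k)%N -> A' i (x i w)].
  apply/seteqP; split=> [w wA' i ik|w wA' i].
    by have := wA' i; rewrite /truncated_sequence ik.
  by rewrite /truncated_sequence; case: ltnP => [|/A'0//]; exact: wA'.
pose A'' i := if i == k then B else A' i.
have -> : truncated_sequence x k @^-1` rectangle A' `&` x k @^-1` B =
    [set w | forall i, (i < k.+1)%N -> A'' i (x i w)].
  rewrite trE /A''; apply/seteqP; split=> [w [wA' wB] i|w wA''].
    by rewrite ltnS leq_eqVlt; case: eqP => [->//|_ /= ik]; exact: wA'.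
  split=> [i ik|]; last by have := wA'' k (leqnn _); rewrite eqxx.
  by have := wA'' i (ltnW ik); rewrite ltn_eqF.
rewrite trE (x_indep (leqW kn) mA') x_indep//; last first.
  by move=> i; rewrite /A''; case: eqP.
rewrite big_ord_recr /= /A'' eqxx; congr (_ * _)%E.
by apply: eq_bigr => i _; rewrite ltn_eqF.
Qed.

(** On nonnegative coordinates, the reciprocal of the joint density of [k] independent exponential
    variables of rate [a]. *)
Definition exponential_weight (k : nat) (z : infseq R) : R :=
  \prod_(i < k) (expR (a * z i) / a).

Lemma exponential_weight_ge0 (k : nat) (z : infseq R) :
  0 <= exponential_weight k z.
Proof.
apply: prodr_ge0 => i _; rewrite mulr_ge0 ?expR_ge0// invr_ge0.
exact: ltW.
Qed.

Lemma measurable_exponential_weight (k : nat) :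
  measurable_fun [set: infseq R] (exponential_weight k).
Proof.
apply: measurable_prod => i _; apply: measurable_funM => //.
apply: measurableT_comp => //; apply: measurable_funM => //.
exact: measurable_coordinate.
Qed.

(* The weight cancels the exponential density and leaves Lebesgue measure, so
   that the result does not depend on the rate a. *)
Lemma integral_exponential_weight (k : nat) (g : infseq R -> \bar R) :
  (k <= n)%N -> measurable_fun [set: infseq R] g -> (forall z, 0 <= g z)%E ->
  (\int[P]_w (g (truncated_sequence x k w) *
     (exponential_weight k (truncated_sequence x k w))%:E) =
   orthant_integral k g)%E.
Proof.
elim: k g => [|k IHk] g kn mg g0.
  have trE w : truncated_sequence x 0 w = (fun=> 0) by exact/funext.
  under eq_integral do rewrite /exponential_weight big_ord0 mule1 trE.
  rewrite integral_cst// -[RHS]mule1; congr (_ * _)%E.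
  exact: probability_setT.
pose G (z : infseq R) :=
  (\int[lebesgue_measure]_(y in [set` `[0%R, +oo[]) g (set_coordinate k z y))%E.
have mgs : measurable_fun [set: infseq R * R]
    (fun zy => g (set_coordinate k zy.1 zy.2)).
  exact: (measurableT_comp mg (measurable_set_coordinate k)).
pose h (zy : infseq R * R) :=
  (g (set_coordinate k zy.1 zy.2) *
   (exponential_weight k zy.1 * (expR (a * zy.2) / a))%:E)%E.
have mh : measurable_fun [set: infseq R * R] h.
  apply: emeasurable_funM => //; apply/measurable_EFinP/measurable_funM.
    exact: (measurableT_comp (measurable_exponential_weight k) measurable_fst).
  apply: measurable_funM => //; apply: measurableT_comp => //.
  by apply: measurable_funM => //; exact: measurable_snd.
have h0 zy : (0 <= h zy)%E.
  rewrite mule_ge0// lee_fin mulr_ge0 ?exponential_weight_ge0//.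
  by rewrite mulr_ge0 ?expR_ge0// invr_ge0 ltW.
(* The last coordinate is split off, so that it can be integrated against its own exponential law by
   independence. *)
transitivity (\int[P]_w h (truncated_sequence x k w, x k w))%E.
  apply: eq_integral => w _; rewrite truncated_sequenceS /h /=; congr (_ * _%:E)%E.
  rewrite /exponential_weight big_ord_recr /= {2}/set_coordinate eqxx.
  by congr (_ * _); apply: eq_bigr => i _; rewrite /set_coordinate ltn_eqF.
rewrite (@ge0_integral_independent _ _ _ _ (infseq R) (measurableTypeR R) _ P
  (truncated_sequence x k) (x k) (exponential_measure a_gt0) h)//; last 4 first.
- exact: measurable_truncated_sequence.
- exact: mx.
- by move=> B mB; exact: x_law.
- by move=> A B mA mB; apply: truncated_sequence_independent => //; exact: ltnW.
rewrite [RHS]/= -IHk; last 3 first.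
- exact: ltnW.
- rewrite /G; under eq_fun do rewrite integral_mkcond epatch_indic.
  pose h' (zy : infseq R * measurableTypeR R) := (g (set_coordinate k zy.1 zy.2) *
    (\1_[set` `[0%R, +oo[] zy.2)%:E)%E.
  apply: (@measurable_fun_fubini_tonelli_F _ _ _ _ _ lebesgue_measure h').
    apply: emeasurable_funM; first exact: mgs.
    apply/measurable_EFinP; apply: (measurableT_comp _ measurable_snd).
    exact: measurable_indic.
  by move=> z; rewrite mule_ge0.
- by move=> z; exact: integral_ge0.
apply: eq_integral => w _; set z := truncated_sequence x k w.
rewrite ge0_integral_exponential//; last first.
  exact: (measurableT_comp mh (pair1_measurable z)).
rewrite /G -ge0_integralZr//; last 2 first.
- apply: measurable_funTS; exact: (measurableT_comp mgs (pair1_measurable z)).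
- by rewrite lee_fin exponential_weight_ge0.
rewrite [RHS]integral_mkcond; apply: eq_integral => y _; rewrite /h /= patchE.
(* For negative [y] both integrands vanish, one through the density and the other through the domain
   of integration. *)
have [y0|y0] := leP 0 y; last first.
  rewrite memNset/= ?lt0_exponential_pdf ?mule0// in_itv /= andbT.
  by apply/negP; rewrite -ltNge.
rewrite mem_set/= ?in_itv ?andbT//=.
rewrite exponential_pdfE// -muleA -EFinM; congr (_ * _%:E)%E.
rewrite -mulrA mulNr expRN -[RHS]mulr1; congr (_ * _).
by field; rewrite !gt_eqF// expR_gt0.
Qed.

Lemma exponential_tail (i : nat) (s : R) : 0 <= s ->
  P (x i @^-1` [set` `]s, +oo[]) = (expR (- (a * s)))%:E.
Proof.
move=> s0.
have -> : x i @^-1` [set` `]s, +oo[] = ~` (x i @^-1` [set` `[0, s]]).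
  apply/seteqP; split=> w; rewrite /= !in_itv /= andbT.
  - by move=> sx /andP[_]; rewrite leNgt sx.
  - move=> xs; rewrite ltNge; apply/negP => sx; apply: xs.
    by rewrite (ltW (x_gt0 i w)).
have m0s : measurable [set` `[0, s]] by [].
rewrite probability_setC; last exact: mpre.
(* At [s = 0] the interval is a single point, whose preimage is empty because [x i] is positive;
   [exponential_prob_itv0c] handles [0 < s]. *)
rewrite x_law//; move: s0; rewrite le_eqVlt => /predU1P[<-|s0].
  rewrite mulr0 oppr0 expR0 -(x_law i)// (_ : x i @^-1` _ = set0); last first.
    rewrite -subset0 => w /=; rewrite in_itv /= => /andP[_].
    by rewrite leNgt x_gt0.
  by rewrite measure0 sube0.
rewrite exponential_prob_itv0c// mulNr -[1%E]/(1%:E) -!EFinB; congr EFin.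
by ring.
Qed.

(** Given the first [n] variables, with sum [z <= t], the next one exceeds [t - z] with probability
    [expR (- (a * (t - z)))]. This is [expR (- (a * t)) * a ^+ n] times [exponential_weight], which
    [integral_exponential_weight] converts into Lebesgue measure. *)
Lemma truncated_sequence_law (t : R) (A : set (infseq R)) : measurable A ->
  P [set w | \sum_(i < n) x i w <= t < \sum_(i < n.+1) x i w /\
             A (truncated_sequence x n w)] =
  ((expR (- (a * t)) * a ^+ n)%:E *
   orthant_integral n (fun z =>
     (\1_(A `&` [set z : infseq R | \sum_(i < n) z i <= t]) z)%:E))%E.
Proof.
move=> mA; pose B := A `&` [set z : infseq R | \sum_(i < n) z i <= t].
have msum : measurable_fun [set: infseq R] (fun z : infseq R => \sum_(i < n) z i).
  by apply: measurable_sum => i; exact: measurable_coordinate.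
have mB : measurable B.
  apply: measurableI => //; rewrite -[X in measurable X]setTI.
  by apply: (msum measurableT [set` `]-oo, t]]).
pose g z := (\1_B z)%:E : \bar R.
have mg : measurable_fun [set: infseq R] g.
  by apply/measurable_EFinP; exact: measurable_indic.
have g0 z : (0 <= g z)%E by rewrite lee_fin.
pose S (zy : infseq R * measurableTypeR R) : measurableTypeR R :=
  \sum_(i < n) zy.1 i + zy.2.
have mS : measurable [set zy | S zy > t].
  have -> : [set zy | S zy > t] = setT `&` S @^-1` [set` `]t, +oo[].
    by rewrite setTI; apply/seteqP; split=> zy /=; rewrite in_itv /= andbT.
  suff mS : measurable_fun [set: infseq R * measurableTypeR R] S by exact: mS.
  apply: measurable_funD; last exact: measurable_snd.
  exact: (measurableT_comp msum measurable_fst).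
pose h zy : \bar R := (g zy.1 * (\1_[set zy | S zy > t] zy)%:E)%E.
have mh : measurable_fun [set: infseq R * measurableTypeR R] h.
  apply: emeasurable_funM; first exact: (measurableT_comp mg measurable_fst).
  by apply/measurable_EFinP; exact: measurable_indic.
have mtx : measurable_fun [set: Om]
    (fun w => (truncated_sequence x n w, x n w : measurableTypeR R)).
  apply: measurable_fun_pair; first exact: measurable_truncated_sequence.
  exact: mx.
have sumE w : \sum_(i < n) truncated_sequence x n w i = \sum_(i < n) x i w.
  by apply: eq_bigr => i _; rewrite /truncated_sequence ltn_ord.
transitivity (\int[P]_w h (truncated_sequence x n w, x n w))%E.
  pose C := (B `*` setT) `&` [set zy | S zy > t].
  have mC : measurable C by apply: measurableI => //; exact: measurableX.
  have mC' : measurable ((fun w => (truncated_sequence x n w,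
      x n w : measurableTypeR R)) @^-1` C).
    by rewrite -[X in measurable X]setTI; exact: mtx.
  transitivity (\int[P]_w (\1_((fun w => (truncated_sequence x n w,
      x n w : measurableTypeR R)) @^-1` C) w)%:E)%E.
    rewrite integral_indic// setIT; congr (P _).
    apply/seteqP; split=> w; rewrite /C /B /S /= !sumE big_ord_recr /=.
      by move=> [/andP[? ?] ?].
    by move=> [[[? ->] _] ->].
  apply: eq_integral => w _; rewrite /h /g /= -EFinM !indicE; congr EFin.
  rewrite -natrM mulnb; congr (_%:R); congr nat_of_bool.
  apply/idP/andP; rewrite !inE; first by move=> [[? _] ?].
  by move=> [? ?].
have h0 zy : (0 <= h zy)%E by apply: mule_ge0; rewrite lee_fin.
rewrite (@ge0_integral_independent _ _ _ _ (infseq R) (measurableTypeR R) _ P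
  (truncated_sequence x n) (x n) (exponential_measure a_gt0) h)//; last 4 first.
- exact: measurable_truncated_sequence.
- exact: mx.
- by move=> D mD; exact: x_law.
- by move=> D D' mD mD'; exact: truncated_sequence_independent.
rewrite -(integral_exponential_weight (leqnn n) mg)//.
rewrite -ge0_integralZl_EFin//; last 3 first.
- by move=> w _; apply: mule_ge0; rewrite lee_fin// exponential_weight_ge0.
- apply: emeasurable_funM.
    exact: (measurableT_comp mg (measurable_truncated_sequence n mx)).
  apply/measurable_EFinP.
  apply: (measurableT_comp (measurable_exponential_weight n)).
  exact: measurable_truncated_sequence.
- by rewrite mulr_ge0 ?expR_ge0 ?exprn_ge0// ltW.
apply: eq_integral => w _; set z := truncated_sequence x n w.
transitivity (\int[exponential_measure a_gt0]_y
    (g z * (\1_[set` `]t - \sum_(i < n) z i, +oo[] y)%:E))%E.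
  apply: eq_integral => y _; rewrite /h /S /=; congr (_ * _%:E)%E.
  rewrite !indicE; congr (_%:R); congr nat_of_bool.
  by apply/idP/idP; rewrite !inE /= in_itv/= andbT ltrBlDl.
have mI : measurable [set` `]t - \sum_(i < n) z i, +oo[] by [].
rewrite ge0_integralZl_EFin//; last first.
  by apply/measurable_EFinP; exact: measurable_indic.
rewrite integral_indic// setIT -[exponential_measure _ _]/(exponential_prob _ _).
rewrite -(x_law n)// /g muleCA !indicE.
case: (boolP (z \in B)) => [|_]; last by rewrite !mul0e.
rewrite inE => -[_ /= zt]; rewrite !mul1e -EFinM exponential_tail ?subr_ge0//.
congr EFin; rewrite /exponential_weight prodf_div -expR_sum.
rewrite prodr_const card_ord mulrBr opprB -mulr_sumr expRD.
by field; rewrite expf_neq0// gt_eqF.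
Qed.

End exponential_variables.

(** * Evaluation of cadlag paths *)

Section metric_borel.
Context {R : realType} {E : ptopologicalType} (dist : E -> E -> R).
Hypotheses (dist_sym : forall x y, dist x y = dist y x)
  (dist_triangle : forall x y z, dist x z <= dist x y + dist y z)
  (nbhs_dist : forall x (U : set E), nbhs x U <->
     exists2 e : R, 0 < e & [set y | dist x y < e] `<=` U).

Lemma measurable_open (U : set E) : open U -> @measurable _ (borel E) U.
Proof. by move=> oU; exact: sub_sigma_algebra. Qed.

(* U is the union of the closed sets of points at distance >= k.+1^-1 from
   its complement. *)
Lemma metric_measurable_limit d (T : measurableType d)
    (u : nat -> T -> E) (v : T -> E) :
  (forall n, @measurable_fun _ _ T (borel E) [set: T] (u n)) ->
  (forall w, u ^~ w @ \oo --> v w) ->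
  @measurable_fun _ _ T (borel E) [set: T] v.
Proof.
move=> mu uv; apply: (@measurability _ _ T (borel E) setT v (@open E)) => //.
move=> _ [U oU <-]; rewrite setTI.
pose C k := [set x | forall z, ~ U z -> k.+1%:R^-1 <= dist x z].
have near_dist w (e : R) : 0 < e -> exists N, forall n, (N <= n)%N ->
    dist (v w) (u n w) < e.
  move=> e0; have : nbhs (v w) [set y | dist (v w) y < e].
    by apply/nbhs_dist; exists e.
  by move=> /uv[N _ Nu]; exists N.
have clC k : open (~` C k).
  rewrite openE => x /existsNP[z /not_implyP[Uz /negP]]; rewrite -ltNge => xz.
  apply/nbhs_dist; exists (k.+1%:R^-1 - dist x z); first by rewrite subr_gt0.
  move=> y /= xy /(_ z Uz); apply/negP; rewrite -ltNge.
  by rewrite (le_lt_trans (dist_triangle y x z))// dist_sym -ltrBrDr.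
have mC k : @measurable _ (borel E) (C k).
  by rewrite -[C k]setCK; apply: measurableC; exact: measurable_open.
(* If [U] contains the ball of radius [e] around [v w], then [u n w] lies in [C k] once
   [k.+1%:R^-1 < e / 2] and [u n w] is within [e / 2] of [v w]. Conversely, if [v w] were outside
   [U], membership in [C k] would keep [u n w] at distance at least [k.+1%:R^-1] from it, against
   convergence. *)
have -> : v @^-1` U = \bigcup_k \bigcup_N \bigcap_(n in [set n | (N <= n)%N])
    (u n @^-1` C k).
  apply/seteqP; split=> [w Uvw|w [k _ [N _ uC]]].
    have [e e0 eU] : exists2 e : R, 0 < e & [set y | dist (v w) y < e] `<=` U.
      by apply/nbhs_dist; move: oU; rewrite openE; exact.
    have [k ke] : exists k, k.+1%:R^-1 < e / 2.
      have [k] := ltr_add_invr (divr_gt0 e0 (ltr0n _ 2)).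
      by rewrite add0r; exists k.
    have [N uN] := near_dist w _ (divr_gt0 e0 (ltr0n _ 2)).
    exists k => //; exists N => // n /= Nn z Uz.
    have vz : e <= dist (v w) z.
      by rewrite leNgt; apply/negP => vz; apply: Uz; exact: eU.
    have un := uN n Nn; have tri := dist_triangle (v w) (u n w) z.
    by apply/ltW; apply: lt_le_trans ke _; lra.
  apply: contrapT => Uvw.
  have [|M uM] := near_dist w k.+1%:R^-1; first by rewrite invr_gt0.
  have := uC (maxn N M) (leq_maxl _ _) _ Uvw.
  by rewrite dist_sym leNgt uM// leq_maxr.
apply: bigcupT_measurable => k; apply: bigcupT_measurable => N.
apply: bigcap_measurable => [|n _]; first by exists N => /=.
by rewrite -[X in measurable X]setTI; exact: mu.
Qed.

End metric_borel.

Section path_evaluation.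
Context {R : realType} {E : ptopologicalType}.
Hypothesis polishE : polish R E.
Local Notation D := (cadlag_path (half_line R) E).

Lemma polish_measurable_limit d (T : measurableType d)
    (u : nat -> T -> E) (v : T -> E) :
  (forall n, @measurable_fun _ _ T (borel E) [set: T] (u n)) ->
  (forall w, u ^~ w @ \oo --> v w) ->
  @measurable_fun _ _ T (borel E) [set: T] v.
Proof.
have [_ [dist [[_ _ sym tri] nbhsE _]]] := polishE.
exact: (metric_measurable_limit sym tri nbhsE).
Qed.

Lemma measurable_path_coordinate (I : set R) (S : ptopologicalType) (s : I) :
  @measurable_fun _ _ (cadlag_path I S) (borel S) setT (fun h => h s).
Proof. by move=> _ B mB; apply: sub_sigma_algebra; exists s => //; exists B. Qed.

Lemma cvg_nat_inv (e : R) : 0 < e ->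
  exists N, forall n, (N <= n)%N -> n.+1%:R^-1 < e.
Proof.
move=> e0; have [N] := ltr_add_invr e0; rewrite add0r => Ne.
exists N => n Nn; apply: le_lt_trans Ne.
by rewrite lef_pV2 ?posrE// ler_nat.
Qed.

(** By right continuity, evaluation is the limit of evaluations on the grid of mesh [n.+1%:R^-1].
    Each of these is measurable, because the grid is countable and its points are fixed coordinates
    of the path. *)
Lemma measurable_path_evaluation :
  @measurable_fun _ _ (D * R)%type (borel E) setT (fun hs => hs.1 (time hs.2)).
Proof.
pose k n (y : R) := Num.truncn (Num.max 0 y * n.+1%:R).
(* The successor puts the grid point strictly to the right of the time, since [right_of] excludes
   the time itself. *)
pose q n (j : nat) : half_line R := time (j.+1%:R / n.+1%:R).
apply: (@polish_measurable_limit _ (D * R)%type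
  (fun n hs => hs.1 (q n (k n hs.2)))) => [n|[h y] /=].
  move=> _ B mB; rewrite setTI.
  have -> : (fun hs : D * R => hs.1 (q n (k n hs.2))) @^-1` B =
      \bigcup_j ((fun h : D => h (q n j)) @^-1` B `*` (k n @^-1` [set j])).
    apply/seteqP; split=> [[h y] /= hB|[h y] [j _ [/= hB ->//]]].
    by exists (k n y).
  apply: bigcupT_measurable => j; apply: measurableX.
    by rewrite -[X in measurable X]setTI; exact: measurable_path_coordinate.
  have -> : k n @^-1` [set j] =
      (fun y => Num.max 0 y * n.+1%:R) @^-1` [set` `[j%:R, j.+1%:R[].
    apply/seteqP; split=> y /=; rewrite in_itv /k /=.
      by move=> <-; apply: truncn_itv; rewrite mulr_ge0// le_max lexx.
    by move=> /truncn_def.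
  rewrite -[X in measurable X]setTI.
  have my : measurable_fun [set: R] (fun y : R => Num.max 0 y * n.+1%:R).
    by apply: measurable_funM => //; exact: measurable_maxr.
  exact: my.
move=> U; have [+ _] := cadlagP h (time y).
move=> /cvg_right_ofP /[apply] -[e e0 eU]; have [N Ne] := cvg_nat_inv e0.
exists N => // n /= Nn; have ne := Ne n Nn.
have y0 : 0 <= Num.max 0 y * n.+1%:R by rewrite mulr_ge0// le_max lexx.
have /andP[ky yk] := truncn_itv y0; rewrite -/(k n y) in ky yk.
have qE : sval (q n (k n y)) = (k n y).+1%:R / n.+1%:R.
  by rewrite val_time// divr_ge0.
apply: eU; rewrite [sval (time y)]/= qE; first by rewrite ltr_pdivlMr.
rewrite -natr1 mulrDl mul1r ler_ltD//.
by rewrite ler_pdivrMr.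
Qed.

(* The default value covers [s <= 0], where h(s-) is not defined. *)
Definition left_limit (hs : D * R) : E :=
  if 0 < hs.2 then left_lim hs.1 hs.2 else point.

(** The left limit is a limit of evaluations at [y * (1 - n.+2%:R^-1)], points that increase to [y]
    from strictly below. The shift by 2 keeps the factor positive, so these points remain in
    [half_line]. *)
Lemma measurable_left_limit :
  @measurable_fun _ _ (D * R)%type (borel E) setT left_limit.
Proof.
pose s n (y : R) := y * (1 - n.+2%:R^-1).
pose u n (hs : D * R) := if 0 < hs.2 then hs.1 (time (s n hs.2)) else point.
apply: (@polish_measurable_limit _ (D * R)%type u) => [n|[h y]].
  apply: (@measurable_fun_ifT _ _ (D * R)%type (borel E)) => //.
  - apply: measurable_fun_ltr => //; exact: measurable_snd.
  - have mhs : measurable_fun [set: D * R] (fun hs : D * R => (hs.1, s n hs.2)).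
      apply: measurable_fun_pair; first exact: measurable_fst.
      by apply: measurable_funM => //; exact: measurable_snd.
    exact: (measurableT_comp measurable_path_evaluation mhs).
rewrite /left_limit /u /=; case: ltP => y0; last exact: cvg_cst.
have [_ [l /cvgP hl]] := cadlagP h (time y).
move=> U; rewrite /left_lim => /((cvg_left_ofP _ _ _).1 hl)[e e0 eU].
have [N Ne] := cvg_nat_inv (divr_gt0 e0 y0).
exists N => // n /= Nn.
have n0 : 0 < n.+2%:R^-1 :> R by [].
have n1 : n.+2%:R^-1 < 1 :> R by rewrite invf_lt1// ltr1n.
have sE : s n y = y - y * n.+2%:R^-1 by rewrite /s mulrBr mulr1.
have sn0 : 0 <= s n y by rewrite mulr_ge0 ?ltW// subr_gt0.
have yn : y * n.+2%:R^-1 < e.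
  rewrite mulrC -ltr_pdivlMr//; apply: lt_trans (Ne n Nn).
  by rewrite ltf_pV2 ?posrE// ltr_nat.
have yn0 := mulr_gt0 y0 n0.
by apply: eU; rewrite (val_time sn0) (val_time (ltW y0)) sE;
  [rewrite ltrD2l ltrN2|rewrite gtrBl].
Qed.

End path_evaluation.

(** * Motion along a spine *)

Section spine.
Context {R : realType} {E : ptopologicalType}.
Local Notation D := (cadlag_path (half_line R) E).
Variables (F : nat -> nat -> E * R -> E) (Q : R.-pker (borel E) ~> D).
Variables (mu : probability (borel E) R) (n : nat) (h j : nat -> nat).
Hypothesis polishE : polish R E.
Hypothesis mF : forall k j : nat, (0 < j <= k)%N ->
  @measurable_fun _ _ (borel E * R)%type (borel E)
    ([set: E] `*` [set` `[0, 1]]) (F k j).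
Hypothesis jh : forall i, (i < n)%N -> (0 < j i <= h i)%N.

(* Lifetimes, and pairs (motion, theta), of the successive particles of a
   spine. *)
Local Notation data := (infseq R * infseq (D * R))%type.

Definition clamp01 (y : R) : R := Num.max 0 (Num.min 1 y).

Lemma clamp01_id (y : R) : 0 <= y <= 1 -> clamp01 y = y.
Proof.
by move=> /andP[y0 y1]; rewrite /clamp01 (min_idPr y1) (max_idPr y0).
Qed.

(* F is measurable on E * [0, 1] only, hence the clamp. *)
Definition spine_start (k : nat) (z : data) : E :=
  F (h k) (j k) (left_limit ((z.2 k).1, z.1 k), clamp01 (z.2 k).2).

(** The form that [motion_law] and [aux_motion_law] share once the spine is fixed: a function of the
    lifetimes, motions and thetas of the preceding particles alone. *)
Definition spine_kernel (k : nat) (z : data) (B : set D) : \bar R :=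
  if k is i.+1 then Q (spine_start i z) B else (\int[mu]_x Q x B)%E.

Lemma measurable_spine_start (k : nat) : (k < n)%N ->
  @measurable_fun _ _ data (borel E) setT (spine_start k).
Proof.
move=> kn.
have mz2 : measurable_fun [set: data] (fun z : data => z.2 k).
  exact: (measurableT_comp (measurable_coordinate k) measurable_snd).
have mz1 : measurable_fun [set: data] (fun z : data => z.1 k).
  exact: (measurableT_comp (measurable_coordinate k) measurable_fst).
apply: (@measurable_comp _ _ _ data (borel E * R)%type (borel E)
  ([set: E] `*` [set` `[0, 1]]) (F (h k) (j k)) setT
  (fun z => (left_limit ((z.2 k).1, z.1 k), clamp01 (z.2 k).2))).
- by apply: (@measurableX _ _ (borel E) R) => //; exact: measurable_itv.
- move=> _ [z _ <-]; split => //=; rewrite in_itv /= /clamp01.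
  by rewrite le_max lexx /= ge_max ler01 ge_min lexx.
- exact: (mF (jh kn)).
- apply: measurable_fun_pair.
    apply: (measurableT_comp (measurable_left_limit polishE)).
    apply: measurable_fun_pair => //.
    exact: (measurableT_comp measurable_fst mz2).
  apply: measurable_maxr => //; apply: measurable_minr => //.
  exact: (measurableT_comp measurable_snd mz2).
Qed.

Lemma measurable_spine_kernel (k : nat) (B : set D) : (k <= n)%N ->
  measurable B -> measurable_fun [set: data] (fun z => spine_kernel k z B).
Proof.
case: k => [_ _|k kn mB]; first exact: measurable_cst.
exact: (measurableT_comp (measurable_kernel Q B mB) (measurable_spine_start kn)).
Qed.

Lemma spine_kernel_ge0 (k : nat) (z : data) (B : set D) :
  (0 <= spine_kernel k z B)%E.
Proof. by case: k => [|k] //=; apply: integral_ge0. Qed.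

(** All [n] completed lifetimes are present from the start, whereas motions and thetas are revealed
    one generation at a time: the history contains the whole tree but only the past trajectories.
    Unrevealed entries hold [point]. *)
Definition spine_data (Om : Type) (x : nat -> Om -> R) (mo : nat -> Om -> D)
    (th : nat -> Om -> R) (k : nat) (w : Om) : data :=
  (truncated_sequence x n w,
   fun i => if (i < k)%N then (mo i w, th i w) else point).

Section spine_markov.
Context d (Om : measurableType d) (P : probability Om R).
Variables (x : nat -> Om -> R) (mo : nat -> Om -> D) (th : nat -> Om -> R).

Lemma measurable_spine_data (k : nat) :
  (forall i, measurable_fun [set: Om] (x i)) ->
  (forall i, (i < k)%N -> measurable_fun [set: Om] (mo i)) ->
  (forall i, (i < k)%N -> measurable_fun [set: Om] (th i)) ->
  measurable_fun [set: Om] (spine_data x mo th k).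
Proof.
move=> mx mmo mth; apply: measurable_fun_pair.
  exact: measurable_truncated_sequence.
apply: measurable_fun_infseq => i; case: ltnP => ik.
  by apply: measurable_fun_pair; [exact: mmo|exact: mth].
exact: measurable_cst.
Qed.

(** The Markov property along the spine, written with integrals over events in place of conditional
    laws. It is the form in which the evolution of each of the two processes enters the
    comparison. *)
Definition spine_markov (G : set Om) : Prop :=
  forall k, (k <= n)%N -> forall (A : set data) (B : set D) (C : set R),
  measurable A -> measurable B -> measurable C ->
  P (G `&` spine_data x mo th k @^-1` A `&` mo k @^-1` B `&` th k @^-1` C) =
  (\int[P]_(w in G `&` spine_data x mo th k @^-1` A)
    (spine_kernel k (spine_data x mo th k w) B * uniform_prob (@ltr01 R) C))%E.

End spine_markov.

(** Induction on the generation. At 0 the data reduce to the lifetimes, which is the hypothesis;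
    passing from [k] to [k.+1] integrates the common kernel against laws that are already
    proportional, and the constant [c] is unchanged. *)
Lemma spine_data_law d d' (Om : measurableType d) (Om' : measurableType d')
    (P : probability Om R) (P' : probability Om' R) (c : {nonneg R})
    (x : nat -> Om -> R) (mo : nat -> Om -> D) (th : nat -> Om -> R)
    (x' : nat -> Om' -> R) (mo' : nat -> Om' -> D) (th' : nat -> Om' -> R)
    (G : set Om) (G' : set Om') (k : nat) :
  measurable G -> measurable G' ->
  (forall i, measurable_fun [set: Om] (x i)) ->
  (forall i, measurable_fun [set: Om] (mo i)) ->
  (forall i, measurable_fun [set: Om] (th i)) ->
  (forall i, measurable_fun [set: Om'] (x' i)) ->
  (forall i, measurable_fun [set: Om'] (mo' i)) ->
  (forall i, measurable_fun [set: Om'] (th' i)) ->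
  spine_markov P x mo th G -> spine_markov P' x' mo' th' G' ->
  proportional_laws P P' G G' c
    (truncated_sequence x n) (truncated_sequence x' n) ->
  (k <= n.+1)%N ->
  proportional_laws P P' G G' c (spine_data x mo th k) (spine_data x' mo' th' k).
Proof.
move=> mG mG' mx mmo mth mx' mmo' mth' PG PG' law0.
have mdata i : measurable_fun [set: Om] (spine_data x mo th i).
  exact: measurable_spine_data.
have mdata' i : measurable_fun [set: Om'] (spine_data x' mo' th' i).
  exact: measurable_spine_data.
elim: k => [_ A mA|k IHk kn].
  have mA0 : measurable ((fun z : infseq R => (z, fun=> point) : data) @^-1` A).
    by rewrite -[X in measurable X]setTI; exact: pair2_measurable.
  exact: law0 mA0.
have {}IHk := IHk (ltnW kn); rewrite ltnS in kn.
pose Y w := (mo k w, th k w); pose Y' w := (mo' k w, th' k w).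
have mY : measurable_fun [set: Om] Y by exact: measurable_fun_pair.
have mY' : measurable_fun [set: Om'] Y' by exact: measurable_fun_pair.
have pairlaw : proportional_laws P P' G G' c
    (fun w => (spine_data x mo th k w, Y w))
    (fun w => (spine_data x' mo' th' k w, Y' w)).
  apply: proportional_laws_pair => // A W mA.
  have mGA : measurable (G `&` spine_data x mo th k @^-1` A).
    apply: measurableI => //.
    by rewrite -[X in measurable X]setTI; exact: mdata.
  have mGA' : measurable (G' `&` spine_data x' mo' th' k @^-1` A).
    apply: measurableI => //.
    by rewrite -[X in measurable X]setTI; exact: mdata'.
  (* The extension from boxes is used twice: outside for the data against the new pair, and here for
     the motion against the theta. *)
  move: W; apply: (proportional_laws_pair mGA mGA') => // B C mB mC.
  rewrite PG// PG'//.
  apply: (proportional_laws_integral mGA mGA' (mdata k) (mdata' k)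
    (g := fun z => (spine_kernel k z B * uniform_prob (@ltr01 R) C)%E)).
  - move=> A' mA'; have mAA' : measurable (A `&` A') by exact: measurableI.
    by have := IHk _ mAA'; rewrite !preimage_setI !setIA.
  - apply: emeasurable_funM; last exact: measurable_cst.
    exact: measurable_spine_kernel.
  - move=> z; apply: mule_ge0; first exact: spine_kernel_ge0.
    exact: measure_ge0.
pose phi (zy : data * (D * R)) : data := (zy.1.1, set_coordinate k zy.1.2 zy.2).
have mphi : measurable_fun [set: data * (D * R)] phi.
  apply: measurable_fun_pair.
    exact: (measurableT_comp measurable_fst measurable_fst).
  have mzy : measurable_fun [set: data * (D * R)]
      (fun zy : data * (D * R) => (zy.1.2, zy.2)).
    apply: measurable_fun_pair; last exact: measurable_snd.
    exact: (measurableT_comp measurable_snd measurable_fst).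
  exact: (measurableT_comp (measurable_set_coordinate k) mzy).
have dataS T (y : nat -> T -> R) m v (w : T) :
    spine_data y m v k.+1 w = phi (spine_data y m v k w, (m k w, v k w)).
  congr pair; apply/funext => i; rewrite /set_coordinate /= ltnS leq_eqVlt.
  by case: eqP => [->|].
move=> A mA; have mphiA : measurable (phi @^-1` A).
  by rewrite -[X in measurable X]setTI; exact: mphi.
have := pairlaw _ mphiA.
by congr (P _ = (_ * P' _)%E); apply/seteqP; split=> w /=; rewrite dataS.
Qed.

End spine.

(** With a constant second coordinate the map is continuous, hence measurable for the Borel sets of
    the product topology, which are those that [cylinders] imposes on the values of a path. Along a
    fixed spine the logarithmic coordinate is indeed constant between branchings. *)
Lemma measurable_borel_pair (E S : ptopologicalType) (c : S) :
  @measurable_fun _ _ (borel E) (borel (E * S)%type) setT (fun y => (y, c)).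
Proof.
apply: (@measurability _ _ (borel E) (borel (E * S)%type) setT _
  (@open (E * S)%type)) => //.
move=> _ [U oU <-]; rewrite setTI; apply: measurable_open.
apply: open_comp => // y _; apply: cvg_pair; first exact: cvg_id.
exact: cvg_cst.
Qed.

(** * Paths on a bounded interval as functions of the spine data *)

Section spine_path.
Context {R : realType} {E : ptopologicalType}.
Local Notation D := (cadlag_path (half_line R) E).
Variables (n : nat) (h : nat -> nat) (t : R).
Hypothesis polishE : polish R E.
Local Notation data := (infseq R * infseq (D * R))%type.
Local Notation T := [set` `[0, t]].

Definition spine_sum (i : nat) (z : nat -> R) : R := \sum_(k < i) z k.

(** The upper bound is dropped at [i = n]: the lifetime of the last particle is not part of the
    data, and on the event that it is alive at [t] it covers the rest of the interval. *)
Definition spine_active (i : nat) (z : nat -> R) (s : R) : bool :=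
  (spine_sum i z <= s) && ((i < n)%N ==> (s < spine_sum i.+1 z)).

Definition spine_value (i : nat) (z : data) (s : R) : E * R :=
  ((z.2 i).1 (time (s - spine_sum i z.1)), \sum_(k < i) ln (h k)%:R).

Lemma spine_active_exists (z : nat -> R) (s : R) : 0 <= s ->
  exists2 i, (i <= n)%N & spine_active i z s.
Proof.
move=> s0; suff : forall m, (m <= n)%N -> spine_sum m z <= s \/
    exists2 i, (i <= n)%N & spine_active i z s.
  move=> /(_ n (leqnn n))[ns|//]; exists n => //.
  by rewrite /spine_active ns ltnn.
elim=> [_|m IHm mn]; first by left; rewrite /spine_sum big_ord0.
have [ms|] := IHm (ltnW mn); last by right.
have [|sm] := leP (spine_sum m.+1 z) s; first by left.
by right; exists m; rewrite ?(ltnW mn)// /spine_active ms sm implybT.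
Qed.

Lemma measurable_spine_sum (i : nat) :
  measurable_fun [set: data] (fun z : data => spine_sum i z.1).
Proof.
apply: measurable_sum => k.
exact: (measurableT_comp (measurable_coordinate k) measurable_fst).
Qed.

Lemma measurable_spine_active (i : nat) (s : R) :
  measurable [set z : data | spine_active i z.1 s].
Proof.
have msum k := measurable_spine_sum k.
have -> : [set z : data | spine_active i z.1 s] =
    ((fun z => spine_sum i z.1) @^-1` [set` `]-oo, s]]) `&`
    [set z : data | (i < n)%N ==> (s < spine_sum i.+1 z.1)].
  apply/seteqP; split=> z; rewrite /= /spine_active in_itv /=; first by move/andP.
  by move=> ?; apply/andP.
apply: measurableI.
  by rewrite -[X in measurable X]setTI; exact: msum.
case: ltnP => _; last first.
  suff -> : [set z : data | false ==> (s < spine_sum i.+1 z.1)] = setT.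
    exact: measurableT.
  by apply/seteqP; split.
rewrite [X in measurable X](_ : _ =
  setT `&` (fun z : data => spine_sum i.+1 z.1) @^-1` [set` `]s, +oo[]).
  exact: msum.
by rewrite setTI; apply/seteqP; split=> z /=; rewrite in_itv /= andbT.
Qed.

Lemma measurable_spine_value (i : nat) (s : R) :
  @measurable_fun _ _ data (borel (E * R)%type) setT
    (fun z => spine_value i z s).
Proof.
apply: (@measurable_comp _ _ _ data (borel E) (borel (E * R)%type) setT
  (fun y => (y, \sum_(k < i) ln (h k)%:R : R)) setT
  (fun z => (z.2 i).1 (time (s - spine_sum i z.1)))) => //.
  exact: measurable_borel_pair.
have mz : measurable_fun [set: data]
    (fun z : data => ((z.2 i).1, s - spine_sum i z.1)).
  apply: measurable_fun_pair.
    apply: (measurableT_comp measurable_fst).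
    exact: (measurableT_comp (measurable_coordinate i) measurable_snd).
  by apply: measurable_funB => //; exact: measurable_spine_sum.
exact: (measurableT_comp (measurable_path_evaluation polishE) mz).
Qed.

Definition follows_spine (Om : Type) (G : set Om) (z : Om -> data)
    (Z : Om -> cadlag_path T (E * R)%type) : Prop :=
  forall w, G w -> forall (s : T) i, (i <= n)%N ->
    spine_active i (z w).1 (sval s) -> Z w s = spine_value i (z w) (sval s).

(** On the two events the paths are the same function of their data. The sets [B] for which a single
    [A] serves both sides form a sigma-algebra, and for a coordinate at time [s] the set [A] is
    obtained by splitting according to the active index. The common [A] is what transfers
    proportionality from data to paths. *)
Lemma spine_event (Om Om' : Type) (G : set Om) (G' : set Om')
    (z : Om -> data) (z' : Om' -> data)
    (Z : Om -> cadlag_path T (E * R)%type)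
    (Z' : Om' -> cadlag_path T (E * R)%type) :
  follows_spine G z Z -> follows_spine G' z' Z' ->
  forall B, measurable B -> exists A : set data, [/\ measurable A,
    G `&` Z @^-1` B = G `&` z @^-1` A & G' `&` Z' @^-1` B = G' `&` z' @^-1` A].
Proof.
move=> GZ GZ'.
pose S := [set B | exists A : set data, [/\ measurable A,
    G `&` Z @^-1` B = G `&` z @^-1` A & G' `&` Z' @^-1` B = G' `&` z' @^-1` A]].
suff : (measurable : set (set (cadlag_path T (E * R)%type))) `<=` S by [].
apply: smallest_sub.
  split.
  - by exists set0; rewrite !preimage_set0.
  - move=> B [A [mA GB GB']]; exists (~` A); split; first exact: measurableC.
    + rewrite setTD; apply/seteqP; split=> w [Gw Bw]; split=> // /= ?.
        by apply: Bw; have [] : (G `&` Z @^-1` B) w by rewrite GB.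
      by apply: Bw; have [] : (G `&` z @^-1` A) w by rewrite -GB.
    + rewrite setTD; apply/seteqP; split=> w [Gw Bw]; split=> // /= ?.
        by apply: Bw; have [] : (G' `&` Z' @^-1` B) w by rewrite GB'.
      by apply: Bw; have [] : (G' `&` z' @^-1` A) w by rewrite -GB'.
  - move=> B /choice[A AB]; exists (\bigcup_i A i); split.
    + by apply: bigcupT_measurable => i; have [] := AB i.
    + rewrite !preimage_bigcup !setI_bigcupr.
      by apply: eq_bigcupr => i _; have [] := AB i.
    + rewrite !preimage_bigcup !setI_bigcupr.
      by apply: eq_bigcupr => i _; have [] := AB i.
move=> _ [s _ [B mB <-]].
exists (\bigcup_(i < n.+1) ([set y : data | spine_active i y.1 (sval s)] `&`
  (fun y => spine_value i y (sval s)) @^-1` B)).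
have s0 : 0 <= sval s by have := valP s; rewrite inE /= in_itv /= => /andP[].
have eventE (Om0 : Type) (G0 : set Om0) (z0 : Om0 -> data) Z0 :
    follows_spine G0 z0 Z0 ->
    G0 `&` Z0 @^-1` (setT `&` (fun p => p s) @^-1` B) = G0 `&` z0 @^-1`
    (\bigcup_(i < n.+1) ([set y : data | spine_active i y.1 (sval s)] `&`
      (fun y => spine_value i y (sval s)) @^-1` B)).
  move=> GZ0; apply/seteqP; split=> w [Gw]; last first.
    move=> [i /= i_n [wi]] /=; rewrite -(GZ0 w)//.
  rewrite /= => -[_ Bw]; split => //.
  have [i i_n wi] := spine_active_exists (z0 w).1 s0.
  by exists i => //; split => //=; rewrite -(GZ0 w).
split; [|exact: eventE|exact: eventE].
apply: fin_bigcup_measurable => // i _; apply: measurableI.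
  exact: measurable_spine_active.
by rewrite -[X in measurable X]setTI; exact: measurable_spine_value.
Qed.

Lemma spine_integral d d' (Om : measurableType d) (Om' : measurableType d')
    (P : probability Om R) (P' : probability Om' R) (c : {nonneg R})
    (G : set Om) (G' : set Om') (z : Om -> data) (z' : Om' -> data)
    (Z : Om -> cadlag_path T (E * R)%type)
    (Z' : Om' -> cadlag_path T (E * R)%type)
    (f : cadlag_path T (E * R)%type -> \bar R) :
  measurable G -> measurable G' ->
  measurable_fun setT z -> measurable_fun setT z' ->
  follows_spine G z Z -> follows_spine G' z' Z' ->
  proportional_laws P P' G G' c z z' ->
  measurable_fun [set: cadlag_path T (E * R)%type] f -> (forall p, 0 <= f p)%E ->
  [/\ measurable_fun G Z, measurable_fun G' Z' &
  (\int[P]_(w in G) f (Z w) = c%:num%:E * \int[P']_(w in G') f (Z' w))%E].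
Proof.
move=> mG mG' mz mz' GZ GZ' zz' mf f0.
have ev := spine_event GZ GZ'.
have mZ : measurable_fun G Z.
  move=> _ B /ev[A [mA -> _]]; apply: measurableI => //.
  by rewrite -[X in measurable X]setTI; exact: mz.
have mZ' : measurable_fun G' Z'.
  move=> _ B /ev[A [mA _ ->]]; apply: measurableI => //.
  by rewrite -[X in measurable X]setTI; exact: mz'.
split => //.
have patchE' (U : Type) (H : set U) (V : U -> cadlag_path T (E * R)%type) B :
    H `&` (V \_ H) @^-1` B = H `&` V @^-1` B.
  by apply/seteqP; split=> w [Hw] /=; rewrite patchE mem_set.
(* The paths are controlled on the events only; a default value elsewhere makes them measurable on
   the whole space, as [proportional_laws_integral] requires. *)
transitivity (\int[P]_(w in G) f ((Z \_ G) w))%E.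
  by apply: eq_integral => w wG; rewrite patchE wG.
transitivity (c%:num%:E * \int[P']_(w in G') f ((Z' \_ G') w))%E; last first.
  by congr (_ * _)%E; apply: eq_integral => w wG; rewrite patchE wG.
apply: proportional_laws_integral => //.
- exact: (measurable_restrictT Z mG).1.
- exact: (measurable_restrictT Z' mG').1.
- by move=> B /ev[A [mA ZA ZA']]; rewrite !patchE' ZA ZA'; exact: zz'.
Qed.

End spine_path.

(** * Spines of the branching process *)

Section spine_event.
Context {R : realType}.
Variables (n : nat) (h : nat -> nat) (t : R).

(** For the lifetimes along a word of length [n], this says that its particle is alive at [t],
    provided it belongs to the tree; for the holding times, with [0 <= t], that exactly [n] jumps
    occurred up to time [t]. *)
Definition alive_event (Om : Type) (x : nat -> Om -> R) : set Om :=
  [set w | \sum_(i < n) x i w <= t < \sum_(i < n.+1) x i w].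

Definition marks_event (Om : Type) (nu : nat -> Om -> nat) : set Om :=
  [set w | forall i, (i < n)%N -> nu i w = h i].

Lemma measurable_alive_event d (Om : measurableType d) (x : nat -> Om -> R) :
  (forall i, measurable_fun [set: Om] (x i)) -> measurable (alive_event x).
Proof.
move=> mx; have msum k : measurable_fun [set: Om] (fun w => \sum_(i < k) x i w).
  by apply: measurable_sum => i; exact: mx.
have -> : alive_event x =
    (setT `&` (fun w => \sum_(i < n) x i w) @^-1` [set` `]-oo, t]]) `&`
    (setT `&` (fun w => \sum_(i < n.+1) x i w) @^-1` [set` `]t, +oo[]).
  rewrite !setTI; apply/seteqP; split=> w; rewrite /= !in_itv /= andbT.
    by move/andP.
  by move=> ?; apply/andP.
by apply: measurableI; exact: msum.
Qed.

Lemma measurable_marks_event d (Om : measurableType d) (nu : nat -> Om -> nat) :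
  (forall i, measurable_fun [set: Om] (nu i)) -> measurable (marks_event nu).
Proof.
move=> mnu; have -> : marks_event nu =
    \bigcap_(i in [set i | (i < n)%N]) (nu i @^-1` [set h i]).
  by apply/seteqP; split=> w nuw i; exact: nuw.
apply: bigcap_measurableType => i _; rewrite -[X in measurable X]setTI.
exact: mnu.
Qed.

End spine_event.

(** The prefixes of [u] have distinct sizes. They are therefore distinct words, and the size
    recovers the index of the set attached to each. *)
Lemma independent_prefixes d d' (Om : measurableType d) (T : measurableType d')
    (R : realType) (P : probability Om R) (Xi : word -> Om -> T) (u : word)
    (k : nat) (B : nat -> set T) :
  mutually_independent P Xi -> (k <= (size u).+1)%N ->
  (forall i, measurable (B i)) ->
  P [set w | forall i, (i < k)%N -> B i (Xi (take i u) w)] =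
  (\prod_(i < k) P (Xi (take i u) @^-1` B i))%E.
Proof.
move=> indep ku mB; pose s := [seq take i u | i <- iota 0 k].
have size_takeE i : (i < k)%N -> size (take i u) = i.
  by move=> ik; rewrite size_takel// -ltnS (leq_trans ik).
have us : uniq s.
  rewrite map_inj_in_uniq ?iota_uniq// => i i'.
  rewrite !mem_iota !add0n => /= ik ik' /(congr1 size).
  by rewrite !size_takeE.
have := indep s (fun v => B (size v)) us (fun v => mB _).
have -> : (\prod_(v <- s) P (Xi v @^-1` B (size v)))%E =
    (\prod_(i < k) P (Xi (take i u) @^-1` B i))%E.
  rewrite big_map -[X in iota _ X]subn0 -/(index_iota 0 k) big_mkord.
  by apply: eq_bigr => i _; rewrite size_takeE.
move=> <-; congr (P _); apply/seteqP; split=> w /= wB.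
  move=> v /mapP[i]; rewrite mem_iota add0n => /= ik ->.
  by rewrite size_takeE//; exact: wB.
move=> i ik; rewrite -[X in B X](size_takeE i ik); apply: wB.
by apply/mapP; exists i => //; rewrite mem_iota.
Qed.

Lemma independent_initial d d' (Om : measurableType d) (T : measurableType d')
    (R : realType) (P : probability Om R) (Xi : nat -> Om -> T)
    (k : nat) (B : nat -> set T) :
  mutually_independent P Xi -> (forall i, measurable (B i)) ->
  P [set w | forall i, (i < k)%N -> B i (Xi i w)] =
  (\prod_(i < k) P (Xi i @^-1` B i))%E.
Proof.
move=> indep mB; have := indep (iota 0 k) B (iota_uniq 0 k) mB.
rewrite -[X in \big[_/_]_(_ <- iota _ X) _]subn0 -/(index_iota 0 k) big_mkord.
move=> <-; congr (P _).
apply/seteqP; split=> w /= wB i ik; apply: wB; last by rewrite mem_iota.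
by move: ik; rewrite mem_iota.
Qed.

Definition label1 : label := exist _ 1%N (ltn0Sn 0).
Definition rank_at (u : word) (i : nat) : nat := val (nth label1 u i).

Lemma rank_at_gt0 (u : word) (i : nat) : (0 < rank_at u i)%N.
Proof. exact: valP. Qed.

Lemma treeP (nu : word -> nat) (u : word) :
  tree nu u <-> forall i, (i < size u)%N -> (rank_at u i <= nu (take i u))%N.
Proof.
split=> [uT i iu|uT v j].
  by apply: uT; rewrite -take_nth// prefix_take.
move=> vju; have := size_prefix vju; rewrite size_rcons => vu.
move: vju; rewrite prefixE size_rcons (take_nth label1)// => /eqP/rcons_inj[vE jE].
by rewrite -jE -[in nu v]vE; exact: uT.
Qed.

Section branching_spine.
Context d (Om : measurableType d) {R : realType} {E : ptopologicalType}.
Local Notation D := (cadlag_path (half_line R) E).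
Variables (P : probability Om R) (X : @branching_data _ Om R E).
Variables (F : nat -> nat -> E * R -> E) (Q : R.-pker (borel E) ~> D).
Variables (mu : probability (borel E) R) (r : R) (p : probability nat R).
Hypotheses (r_gt0 : 0 < r) (bmpX : branching_process X F Q mu P r p).
Hypothesis polishE : polish R E.
Hypothesis mF : forall k j : nat, (0 < j <= k)%N ->
  @measurable_fun _ _ (borel E * R)%type (borel E)
    ([set: E] `*` [set` `[0, 1]]) (F k j).
Variables (t : R) (u : word) (h : nat -> nat).
Hypothesis uh : forall i, (i < size u)%N -> (rank_at u i <= h i)%N.

Let n := size u.
Let x i := life X (take i u).
Let nu i := offspring X (take i u).
Let mo i := motion X (take i u).
Let th i := theta X (take i u).
Let G := marks_event n h nu `&` alive_event n t x.

(** The marks depend on the offspring numbers only and the rest on the lifetimes only, so the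
    probability factors. Measurability is checked in the two generated sigma-algebras, which is
    where independence is assumed. *)
Lemma branching_spine_law (A : set (infseq R)) : measurable A ->
  P (G `&` truncated_sequence x n @^-1` A) =
  (\prod_(i < n) p [set h i] * ((expR (- (r * t)) * r ^+ n)%:E *
   orthant_integral n (fun z =>
     (\1_(A `&` [set z : infseq R | \sum_(i < n) z i <= t]) z)%:E)))%E.
Proof.
move=> mA; have [mnu nu_law nu_indep] := offspring_iid bmpX.
have [ml l_law l_indep] := life_iid bmpX.
rewrite -setIA (offspring_life_independent bmpX).
- congr (_ * _)%E.
    have := independent_prefixes nu_indep (leqnSn n)
      (B := fun i => [set h i]) (fun=> I).
    by move=> ->; apply: eq_bigr => i _; exact: nu_law.
  apply: (@truncated_sequence_law _ _ _ P r x n) => //.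
  + by move=> i; exact: ml.
  + by move=> i w; exact: life_gt0.
  + by move=> i B mB; exact: l_law.
  + by move=> k B kn mB; exact: independent_prefixes.
- apply: (@measurable_marks_event n h _
    (g_sigma_algebraType (events [set: word] (offspring X)))).
  move=> i _ B mB; apply: sub_sigma_algebra; exists (take i u) => //.
  by exists B.
- have mx i : @measurable_fun _ _
      (g_sigma_algebraType (events [set: word] (life X))) R setT (x i).
    move=> _ B mB; apply: sub_sigma_algebra; exists (take i u) => //.
    by exists B.
  apply: (@measurableI _ (g_sigma_algebraType (events [set: word] (life X)))).
    exact: measurable_alive_event.
  have := measurable_truncated_sequence n mx measurableT mA.
  by rewrite setTI.
Qed.

(** Offspring numbers and lifetimes of every generation belong to the history, and the motions and
    thetas revealed in the data come from prefixes shorter than [k]. This makes [branching]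
    applicable to the spine event. *)
Lemma branching_spine_history (k : nat)
    (A : set (infseq R * infseq (D * R))) : measurable A ->
  history X k (G `&` spine_data n x mo th k @^-1` A).
Proof.
move=> mA.
set H := events [set: word] (offspring X) `|` events [set: word] (life X) `|`
  events [set v | (size v < k)%N] (motion X) `|`
  events [set v | (size v < k)%N] (theta X).
have mx i : @measurable_fun _ _ (g_sigma_algebraType H) R setT (x i).
  move=> _ B mB; apply: sub_sigma_algebra; left; left; right.
  by exists (take i u) => //; exists B.
have mnu i : @measurable_fun _ _ (g_sigma_algebraType H) nat setT (nu i).
  move=> _ B mB; apply: sub_sigma_algebra; left; left; left.
  by exists (take i u) => //; exists B.
have mmo i : (i < k)%N ->
    @measurable_fun _ _ (g_sigma_algebraType H) D setT (mo i).
  move=> ik _ B mB; apply: sub_sigma_algebra; left; right.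
  exists (take i u); last by exists B.
  by rewrite /= size_take_min (leq_ltn_trans (geq_minl _ _)).
have mth i : (i < k)%N ->
    @measurable_fun _ _ (g_sigma_algebraType H) R setT (th i).
  move=> ik _ B mB; apply: sub_sigma_algebra; right.
  exists (take i u); last by exists B.
  by rewrite /= size_take_min (leq_ltn_trans (geq_minl _ _)).
apply: (@measurableI _ (g_sigma_algebraType H)).
  apply: (@measurableI _ (g_sigma_algebraType H)).
    exact: measurable_marks_event.
  exact: measurable_alive_event.
have := measurable_spine_data n mx mmo mth measurableT mA.
by rewrite setTI.
Qed.

Lemma branching_spine_tree (w : Om) : G w -> tree (offspring X ^~ w) u.
Proof.
by move=> [wh _]; apply/treeP => i iu; rewrite [offspring _ _ _]wh// uh.
Qed.

(** The branching property is applied to the single particle [take k u]. Its membership in the tree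
    is implied by the spine event, since the tree is closed under prefixes. *)
Lemma branching_spine_markov :
  spine_markov F Q mu n h (rank_at u) P x mo th G.
Proof.
move=> k kn A B C mA mB mC.
pose G0 := G `&` spine_data n x mo th k @^-1` A.
have := @branching _ _ _ _ _ _ _ _ _ _ _ bmpX k [:: take k u] isT _ G0
  (branching_spine_history mA) (fun=> B) (fun=> C) (fun=> mB) (fun=> mC).
rewrite /= andbT size_takel// eqxx => /(_ isT).
set inT := [set w | forall v, v \in [:: take k u] -> _].
have -> : G0 `&` inT = G0.
  apply/setIidl => w [Gw _] v; rewrite inE => /eqP ->.
  move=> v' j v'j; apply: (branching_spine_tree Gw).
  exact: prefix_trans v'j (prefix_take _ _).
move=> PG0; transitivity (P (G0 `&` [set w | forall v, v \in [:: take k u] ->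
    B (motion X v w) /\ C (theta X v w)])).
  congr (P _); rewrite -/G0 -setIA; congr (G0 `&` _).
  apply/seteqP; split=> w /=; first by move=> [? ?] v; rewrite inE => /eqP ->.
  by apply; rewrite inE.
rewrite PG0 -/G0; apply: eq_integral => w; rewrite inE => -[Gw _].
rewrite big_seq1; congr (_ * _)%E.
(* The root starts from [mu] in both descriptions. Afterwards [life_gt0] puts [left_limit] in its
   genuine case, [theta_itv] removes the clamp, and the last label of the prefix is the birth
   rank. *)
case: k kn {PG0 inT G0} => [_|k kn]; rewrite /motion_law; first by rewrite take0.
case: eqP => [/(congr1 size)|_]; first by rewrite size_takel.
have kE : (k < k.+1)%N by [].
rewrite /= /initial_position /spine_start /parent /birth_rank.
rewrite size_takel//= take_takel// map_take (take_nth 0%N) ?size_map//.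
rewrite last_rcons kE /= /truncated_sequence kn /left_limit /= life_gt0.
rewrite clamp01_id; last exact: theta_itv.
rewrite [offspring _ _ _](Gw.1 k)//.
by rewrite (nth_map label1).
Qed.

Lemma branching_follows_spine :
  follows_spine n h G (spine_data n x mo th n.+1) (lineage X u t).
Proof.
move=> w Gw s i i_n; rewrite /spine_active /spine_value /=.
have trE k : (k <= n)%N ->
    spine_sum k (truncated_sequence x n w) = \sum_(j < k) x j w.
  move=> kn; apply: eq_bigr => j _.
  by rewrite /truncated_sequence (leq_trans (ltn_ord j)).
rewrite ltnS i_n trE// => /andP[is_ si].
have aE : ancestor (life X ^~ w) u (sval s) = take i u.
  apply: ancestor_take => //; first by move=> v; exact: life_gt0.
  apply/implyP => ilt; move: si; rewrite ilt /= => si.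
  by apply: (lt_le_trans si); rewrite trE.
rewrite /position aE /lineage_log aE birth_take//; congr pair.
rewrite /strict_prefixes big_map size_takel//.
rewrite -[X in iota _ X]subn0 -/(index_iota 0 i).
rewrite big_mkord.
apply: eq_bigr => k _; rewrite take_takel ?(ltnW (ltn_ord k))//.
by rewrite [offspring _ _ _](Gw.1 k)// (leq_trans (ltn_ord k)).
Qed.

Lemma measurable_branching_spine : measurable G.
Proof.
have [mnu _ _] := offspring_iid bmpX; have [ml _ _] := life_iid bmpX.
apply: measurableI.
  by apply: measurable_marks_event => i; exact: mnu.
by apply: measurable_alive_event => i; exact: ml.
Qed.

End branching_spine.

(** * Spines of the auxiliary process *)

Section auxiliary_spine.
Context d (Om : measurableType d) {R : realType} {E : ptopologicalType}.
Local Notation D := (cadlag_path (half_line R) E).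
Variables (P : probability Om R) (Y : @auxiliary_data _ Om R E).
Variables (F : nat -> nat -> E * R -> E) (Q : R.-pker (borel E) ~> D).
Variables (mu : probability (borel E) R) (r : R) (p : probability nat R).
Hypotheses (r_gt0 : 0 < r) (mean_gt0 : 0 < mean p).
Hypothesis auxY : auxiliary_process Y F Q mu P r p.
Variables (t : R) (n : nat) (h j : nat -> nat).
Hypothesis jh : forall i, (i < n)%N -> (0 < j i <= h i)%N.

Let x := holding (jumps Y).
Let index_event := [set w | forall i, (i < n)%N -> child_index Y i w = j i].
Let G := marks_event n h (mark Y) `&` alive_event n t x `&` index_event.

Lemma jump_count_alive (s : R) (w : Om) (k : nat) : 0 <= s ->
  (jump_count (jumps Y) s w == k) =
  (\sum_(i < k) x i w <= s < \sum_(i < k.+1) x i w).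
Proof. by move=> s0; rewrite ltNge -!countP// -leqNgt eqn_leq andbC. Qed.

(** Independence from the marks is assumed for the counting process, so the holding times must be
    recovered from it: for [0 <= s], the [k]-th jump time exceeds [s] exactly when fewer than [k]
    jumps occurred by [s], and a holding time is a difference of two jump times. *)
Let mx i : @measurable_fun _ _ (g_sigma_algebraType (jump_events Y)) R setT (x i).
Proof.
have mjump k : @measurable_fun _ _ (g_sigma_algebraType (jump_events Y)) R setT
    (fun w => \sum_(i < k) x i w).
  apply: (measurability _ (RGenOInfty.measurableE R)).
  move=> _ [_ [s ->] <-]; rewrite setTI.
  have [s0|s0] := leP 0 s; last first.
    rewrite (_ : _ @^-1` _ = setT); first exact: measurableT.
    apply/seteqP; split=> // w _ /=; rewrite in_itv /= andbT.
    apply: lt_le_trans s0 _; apply: sumr_ge0 => k' _.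
    by apply/ltW; exact: holding_gt0.
  have -> : (fun w => \sum_(i < k) x i w) @^-1` [set` `]s, +oo[] =
      jump_count (jumps Y) s @^-1` [set k' | (k' < k)%N].
    apply/seteqP; split=> w /=; rewrite in_itv /= andbT ltNge -countP//.
      by rewrite -ltnNge.
    by rewrite -ltnNge.
  apply: sub_sigma_algebra; exists s => //.
  by exists [set k' | (k' < k)%N] => //; rewrite setTI.
have -> : x i = (fun w => \sum_(k < i.+1) x k w - \sum_(k < i) x k w).
  by apply/funext => w; rewrite big_ord_recr /= addrAC subrr add0r.
by apply: measurable_funB; exact: mjump.
Qed.

(** The index contributes a factor 1 / h_i that cancels the size bias of the mark, and the factors 1
    / m of the marks turn [(r * mean p) ^+ n] into [r ^+ n]. What remains differs from
    [branching_spine_law] by the exponential factor alone. *)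
Lemma auxiliary_spine_law (A : set (infseq R)) : measurable A ->
  P (G `&` truncated_sequence x n @^-1` A) =
  (\prod_(i < n) p [set h i] * ((expR (- (r * mean p * t)) * r ^+ n)%:E *
   orthant_integral n (fun z =>
     (\1_(A `&` [set z : infseq R | \sum_(i < n) z i <= t]) z)%:E)))%E.
Proof.
move=> mA; have [mh h_law h_indep] := jumps_poisson auxY.
pose L := alive_event n t x `&` truncated_sequence x n @^-1` A.
pose M := marks_event n h (mark Y).
have mM : <<s mark_events Y >> M.
  apply: (@measurable_marks_event n h _ (g_sigma_algebraType (mark_events Y))).
  by move=> i _ B mB; apply: sub_sigma_algebra; exists i => //; exists B.
have mL : <<s jump_events Y >> L.
  apply: (@measurableI _ (g_sigma_algebraType (jump_events Y))).
    exact: measurable_alive_event.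
  have := measurable_truncated_sequence n mx measurableT mA.
  by rewrite setTI.
have mML : <<s jump_events Y `|` mark_events Y >> (M `&` L).
  apply: (@measurableI _ (g_sigma_algebraType (jump_events Y `|` mark_events Y))).
    by apply: sub_sigma_algebra2 mM => B; right.
  by apply: sub_sigma_algebra2 mL => B; left.
have mML' : measurable (M `&` L).
  apply: measurableI.
    by apply: measurable_marks_event => i; exact: measurable_mark auxY _.
  apply: measurableI; first by apply: measurable_alive_event => i; exact: mh.
  rewrite -[X in measurable X]setTI.
  by apply: measurable_truncated_sequence => // i; exact: mh.
have -> : G `&` truncated_sequence x n @^-1` A = (M `&` L) `&` index_event.
  by rewrite /G /M /L -!setIA; congr (_ `&` (_ `&` _)); rewrite setIC.
rewrite (index_uniform auxY n j mML).
(* On [M] the marks are the prescribed numbers and every rank is admissible, so the integrand is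
   constant. *)
transitivity (\int[P]_(w in M `&` L) (\prod_(k < n) (h k)%:R^-1)%:E)%E.
  apply: eq_integral => w; rewrite inE => -[Mw _]; congr EFin.
  by apply: eq_bigr => k _; rewrite Mw// jh.
transitivity ((\prod_(k < n) (h k)%:R^-1)%:E * P (M `&` L))%E.
  exact: integral_cst.
rewrite (mark_jumps_independent auxY mM mL).
have -> : P L = ((expR (- (r * mean p * t)) * (r * mean p) ^+ n)%:E *
   orthant_integral n (fun z =>
     (\1_(A `&` [set z : infseq R | \sum_(i < n) z i <= t]) z)%:E))%E.
  apply: (@truncated_sequence_law _ _ _ P (r * mean p) x n) => //.
  + exact: mulr_gt0.
  + by move=> i w; exact: holding_gt0.
  + by move=> k B kn mB; exact: independent_initial.
have -> : P M = (\prod_(i < n) ((h i)%:R%:E * p [set h i] / (mean p)%:E))%E.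
  have := independent_initial n (mark_independent auxY)
    (B := fun i => [set h i]) (fun=> I).
  by move=> ->; apply: eq_bigr => i _; exact: mark_law auxY _ _.
have pE i : p [set h i] = (fine (p [set h i]))%:E.
  by rewrite fineK// fin_num_measure.
set J := orthant_integral _ _.
rewrite !muleA; congr (_ * J)%E.
have -> : (\prod_(i < n) ((h i)%:R%:E * p [set h i] / (mean p)%:E))%E =
    (\prod_(i < n) ((h i)%:R * fine (p [set h i]) / mean p))%:E.
  rewrite -prodEFin; apply: eq_bigr => i _.
  by rewrite [in LHS]pE inver gt_eqF.
have -> : (\prod_(i < n) p [set h i])%E = (\prod_(i < n) fine (p [set h i]))%:E.
  by rewrite -prodEFin; apply: eq_bigr => i _; rewrite [LHS]pE.
rewrite -!EFinM; congr EFin.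
rewrite 2!big_split /= prodfV prodr_const card_ord exprMn.
(* The cancellation requires every h_k to be nonzero, which holds because h_k is at least the
   positive rank j_k. *)
have h0 : \prod_(k < n) (h k)%:R != 0 :> R.
  apply/prodf_neq0 => k _; rewrite pnatr_eq0 -lt0n.
  by have /andP[j0 /(leq_trans j0)] := jh (ltn_ord k).
have m0 : mean p ^+ n != 0 by rewrite expf_neq0// gt_eqF.
by rewrite exprVn; field; rewrite m0.
Qed.

Lemma auxiliary_spine_history (k : nat)
    (A : set (infseq R * infseq (D * R))) : measurable A ->
  aux_history Y k
    (G `&` spine_data n x (aux_motion Y) (aux_theta Y) k @^-1` A).
Proof.
move=> mA.
set H := jump_events Y `|` mark_events Y `|` events [set: nat] (child_index Y) `|`
  events [set i | (i < k)%N] (aux_motion Y) `|`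
  events [set i | (i < k)%N] (aux_theta Y).
have mxH i : @measurable_fun _ _ (g_sigma_algebraType H) R setT (x i).
  move=> _ B mB; have := mx i measurableT mB.
  by apply: sub_sigma_algebra2 => C; left; left; left; left.
have mnu i : @measurable_fun _ _ (g_sigma_algebraType H) nat setT (mark Y i).
  move=> _ B mB; apply: sub_sigma_algebra; left; left; left; right.
  by exists i => //; exists B.
have mind i :
    @measurable_fun _ _ (g_sigma_algebraType H) nat setT (child_index Y i).
  move=> _ B mB; apply: sub_sigma_algebra; left; left; right.
  by exists i => //; exists B.
have mmo i : (i < k)%N ->
    @measurable_fun _ _ (g_sigma_algebraType H) D setT (aux_motion Y i).
  move=> ik _ B mB; apply: sub_sigma_algebra; left; right.
  by exists i => //; exists B.
have mth i : (i < k)%N ->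
    @measurable_fun _ _ (g_sigma_algebraType H) R setT (aux_theta Y i).
  move=> ik _ B mB; apply: sub_sigma_algebra; right.
  by exists i => //; exists B.
apply: (@measurableI _ (g_sigma_algebraType H)).
  apply: (@measurableI _ (g_sigma_algebraType H)).
    apply: (@measurableI _ (g_sigma_algebraType H)).
      exact: measurable_marks_event.
    exact: measurable_alive_event.
  exact: (@measurable_marks_event n j _ (g_sigma_algebraType H)).
have := measurable_spine_data n mxH mmo mth measurableT mA.
by rewrite setTI.
Qed.

Lemma auxiliary_spine_markov :
  spine_markov F Q mu n h j P x (aux_motion Y) (aux_theta Y) G.
Proof.
move=> k kn A B C mA mB mC.
rewrite -setIA (aux_evolution auxY (auxiliary_spine_history mA) mB mC).
apply: eq_integral => w; rewrite inE => -[Gw _]; congr (_ * _)%E.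
case: k kn => [//|k kn].
have kE : (k < k.+1)%N by [].
rewrite /= /spine_start /= kE /truncated_sequence kn /left_limit /= holding_gt0.
rewrite clamp01_id; last exact: aux_theta_itv.
by rewrite (Gw.1.1 k)// (Gw.2 k).
Qed.

Lemma auxiliary_follows_spine :
  follows_spine n h G (spine_data n x (aux_motion Y) (aux_theta Y) n.+1)
    (aux_path Y t).
Proof.
move=> w Gw s i i_n; rewrite /spine_active /spine_value /=.
have trE k : (k <= n)%N ->
    spine_sum k (truncated_sequence x n w) = \sum_(l < k) x l w.
  move=> kn; apply: eq_bigr => l _.
  by rewrite /truncated_sequence (leq_trans (ltn_ord l)).
rewrite ltnS i_n trE// => /andP[is_ si].
have /andP[s0 st] : 0 <= sval s <= t.
  by have := valP s; rewrite inE /= in_itv.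
have cE : jump_count (jumps Y) (sval s) w = i.
  apply/eqP; rewrite jump_count_alive// is_ /=.
  (* For [i = n] the data give no upper bound; the alive event supplies it, the next jump coming
     after [t]. *)
  move: i_n si; rewrite leq_eqVlt => /predU1P[-> _|ilt].
    by apply: le_lt_trans st _; have /andP[] := Gw.1.2.
  by rewrite ilt /= trE.
rewrite /aux_position cE; congr pair.
by apply: eq_bigr => k _; rewrite (Gw.1.1 k)// (leq_trans (ltn_ord k)).
Qed.

Lemma measurable_auxiliary_spine : measurable G.
Proof.
have [mh _ _] := jumps_poisson auxY.
apply: measurableI; last first.
  apply: (@measurable_marks_event n j _ Om) => i.
  exact: measurable_index auxY _.
apply: measurableI.
  by apply: measurable_marks_event => i; exact: measurable_mark auxY _.
by apply: measurable_alive_event => i; exact: mh.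
Qed.

End auxiliary_spine.

(** * Summation over spines *)

Section esum_countable.
Context {R : realType} {I : countType}.
Local Open Scope ereal_scope.

(** Enumerates the countable index type, with 0 at integers that encode no index, so that sums over
    [I] become series and the results on series of nonnegative terms apply. *)
Let unpickled (a : I -> \bar R) (n : nat) : \bar R :=
  if pickle_inv n is Some i then a i else 0.

Let esum_unpickled (a : I -> \bar R) : (forall i, 0 <= a i) ->
  \esum_(i in [set: I]) a i = \sum_(n <oo) unpickled a n.
Proof.
move=> a0; have b0 n : 0 <= unpickled a n.
  by rewrite /unpickled; case: pickle_inv.
rewrite nneseries_esumT//.
transitivity (\esum_(i in [set: I]) unpickled a (pickle i)).
  by apply: eq_esum => i _; rewrite /unpickled pickleK_inv.
rewrite -(esum_image setT pickle); last first.
  by move=> i i' _ _; exact: (pcan_inj pickleK_inv).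
rewrite esum_mkcond; apply: eq_esum => n _; case: ifPn => // /negP nI.
rewrite /unpickled; case: (pickle_inv n) (@pickle_invK I n) => //= i in_.
by case: nI; apply/mem_set; exists i.
Qed.

Lemma ge0_esumZl (c : R) (a : I -> \bar R) : (0 <= c)%R -> (forall i, 0 <= a i) ->
  \esum_(i in [set: I]) (c%:E * a i) = c%:E * \esum_(i in [set: I]) a i.
Proof.
move=> c0 a0; rewrite !esum_unpickled//; last by move=> i; rewrite mule_ge0.
rewrite -nneseriesZl; last by move=> n _; rewrite /unpickled; case: pickle_inv.
apply: eq_eseriesr => n _; rewrite /unpickled.
by case: pickle_inv; rewrite ?mule0.
Qed.

Lemma ge0_integral_esum d (T : measurableType d) (m : {measure set T -> \bar R})
    (f : I -> T -> \bar R) :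
  (forall i, measurable_fun [set: T] (f i)) -> (forall i x, 0 <= f i x) ->
  \int[m]_x (\esum_(i in [set: I]) f i x) = \esum_(i in [set: I]) \int[m]_x f i x.
Proof.
move=> mf f0; rewrite esum_unpickled; last by move=> i; exact: integral_ge0.
under eq_integral do rewrite esum_unpickled//.
rewrite integral_nneseries//.
- apply: eq_eseriesr => n _; rewrite /unpickled; case: pickle_inv => //.
  exact: integral0.
- by move=> n; rewrite /unpickled; case: pickle_inv.
- by move=> n x _; rewrite /unpickled; case: pickle_inv.
Qed.

End esum_countable.

Lemma counting_esum (R : realType) (T : choiceType) (A : set T) :
  counting A = (\esum_(i in A) 1)%E :> \bar R.
Proof.
rewrite /counting; case: ifPn => /asboolP Afin.
  rewrite esum_fset// fsbig_finite//= -[1%E]/(1%:E) sumEFin.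
  by rewrite big_const_seq count_predT iter_addr_0.
apply/esym/eqyP => M M0; apply: esum_ge.
(* An infinite set has finite subsets of any size; this integer exceeds the arbitrary bound [M]. *)
have [B BA BM] := infinite_set_fset (Num.truncn M).+1 Afin.
exists [set` B]; first by split=> //; exact: finite_fset.
rewrite fsbig_finite//= set_fsetK -[1%E]/(1%:E) sumEFin.
rewrite big_const_seq count_predT iter_addr_0 lee_fin.
apply: le_trans (ltW (truncnS_gt M)) _.
by rewrite ler_nat.
Qed.

(** * Spines as a countable index set, and the many-to-one formula *)

Section spine_decomposition.
Context (R : realType) (r : R) (p : probability nat R) (E : ptopologicalType).
Local Notation D := (cadlag_path (half_line R) E).
Variables (Q : R.-pker (borel E) ~> D) (F : nat -> nat -> E * R -> E).
Hypotheses (r_gt0 : 0 < r) (mean_gt0 : 0 < mean p) (polishE : polish R E).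
Hypothesis mF : forall k j : nat, (0 < j <= k)%N ->
  @measurable_fun _ _ (borel E * R)%type (borel E)
    ([set: E] `*` [set` `[0, 1]]) (F k j).
Variables (t : R) (t_ge0 : 0 <= t) (mu : probability (borel E) R).
Context (d : measure_display) (Om : measurableType d) (P : probability Om R).
Variables (X : branching_data Om E) (bmpX : branching_process X F Q mu P r p).
Context (d' : measure_display) (Om' : measurableType d').
Variables (P' : probability Om' R) (Y : @auxiliary_data _ Om' R E).
Hypothesis auxY : auxiliary_process Y F Q mu P' r p.

(* A spine is a word together with the numbers of offspring of its strict
   prefixes. *)
Implicit Type q : seq (label * nat).

Definition spine_word q : word := unzip1 q.
Definition spine_offspring q (i : nat) : nat := nth 0%N (unzip2 q) i.

Definition admissible q : bool :=
  [forall i : 'I_(size (spine_word q)),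
    (rank_at (spine_word q) i <= spine_offspring q i)%N].

Lemma admissibleP q : reflect (forall i, (i < size (spine_word q))%N ->
    (rank_at (spine_word q) i <= spine_offspring q i)%N) (admissible q).
Proof.
apply: (iffP forallP) => [qa i iq|qa i]; first exact: (qa (Ordinal iq)).
exact: qa.
Qed.

(** An inadmissible [q] is given the empty event, so that sums may range over the whole countable
    type of sequences. The same convention holds for [auxiliary_event]. *)
Definition branching_event q : set Om :=
  [set w | admissible q /\
    (marks_event (size (spine_word q)) (spine_offspring q)
       (fun i => offspring X (take i (spine_word q))) `&`
     alive_event (size (spine_word q)) t
       (fun i => life X (take i (spine_word q)))) w].

Definition auxiliary_event q : set Om' :=
  [set w | admissible q /\
    (marks_event (size (spine_word q)) (spine_offspring q) (mark Y) `&`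
     alive_event (size (spine_word q)) t (holding (jumps Y)) `&`
     [set w | forall i, (i < size (spine_word q))%N ->
       child_index Y i w = rank_at (spine_word q) i]) w].

Lemma spine_eq q q' : spine_word q = spine_word q' ->
  (forall i, (i < size (spine_word q))%N ->
    spine_offspring q i = spine_offspring q' i) -> q = q'.
Proof.
move=> uu hh; rewrite -(zip_unzip q) -(zip_unzip q') -/(spine_word q) uu.
congr zip; have qq' : size q = size q'.
  by rewrite -(size_map fst q) -(size_map fst q') -/(unzip1 q) [unzip1 q]uu.
apply: (@eq_from_nth _ 0%N); first by rewrite !size_map.
by move=> i; rewrite size_map => iq; apply: hh; rewrite size_map.
Qed.

Definition growth : {nonneg R} := NngNum (expR_ge0 (r * (mean p - 1) * t)).

(** The spine laws of the lifetimes have the same weights and the same orthant integral; only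
    [expR (- (r * t))] and [expR (- (r * mean p * t))] differ, with ratio [growth]. The motions and
    then the paths inherit this ratio through [spine_data_law] and [spine_integral]. *)
Lemma spine_many_to_one q
    (f : cadlag_path [set` `[0, t]] (E * R)%type -> \bar R) :
  measurable_fun [set: cadlag_path [set` `[0, t]] (E * R)%type] f ->
  (forall h, 0 <= f h)%E ->
  [/\ measurable (branching_event q), measurable (auxiliary_event q),
    measurable_fun (branching_event q) (lineage X (spine_word q) t),
    measurable_fun (auxiliary_event q) (aux_path Y t) &
    (\int[P]_(w in branching_event q) f (lineage X (spine_word q) t w) =
     growth%:num%:E * \int[P']_(w in auxiliary_event q) f (aux_path Y t w))%E].
Proof.
move=> mf f0; have [qa|nqa] := boolP (admissible q); last first.
  have -> : branching_event q = set0.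
    by rewrite -subset0 => w [qa _]; rewrite qa in nqa.
  have -> : auxiliary_event q = set0.
    by rewrite -subset0 => w [qa _]; rewrite qa in nqa.
  split => //; [exact: measurable_fun_set0|exact: measurable_fun_set0|].
  by rewrite !integral_set0 mule0.
have uh := admissibleP _ qa.
have jh i : (i < size (spine_word q))%N ->
    (0 < rank_at (spine_word q) i <= spine_offspring q i)%N.
  by move=> iq; rewrite rank_at_gt0 uh.
set n := size (spine_word q) in uh jh *.
pose x i := life X (take i (spine_word q)).
pose mo i := motion X (take i (spine_word q)).
pose th i := theta X (take i (spine_word q)).
have -> : branching_event q = marks_event n (spine_offspring q)
    (fun i => offspring X (take i (spine_word q))) `&` alive_event n t x.
  by apply/seteqP; split=> w; [case|split].
have -> : auxiliary_event q = marks_event n (spine_offspring q) (mark Y) `&`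
    alive_event n t (holding (jumps Y)) `&`
    [set w | forall i, (i < n)%N -> child_index Y i w = rank_at (spine_word q) i].
  by apply/seteqP; split=> w; [case|split].
set G := _ `&` alive_event n t x; set G' := _ `&` [set w | _].
have mG : measurable G by exact: measurable_branching_spine bmpX _ _ _.
have mG' : measurable G' by exact: measurable_auxiliary_spine auxY _ _ _ _.
have [ml _ _] := life_iid bmpX; have [mh _ _] := jumps_poisson auxY.
have law0 : proportional_laws P P' G G' growth
    (truncated_sequence x n) (truncated_sequence (holding (jumps Y)) n).
  move=> A mA.
  rewrite (branching_spine_law r_gt0 bmpX t (spine_word q) (spine_offspring q) mA).
  rewrite (auxiliary_spine_law r_gt0 mean_gt0 auxY t jh mA).
  rewrite [RHS]muleCA; congr (_ * _)%E.
  rewrite [RHS]muleA -EFinM; congr (_%:E * _)%E.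
  rewrite mulrA -expRD; congr (expR _ * _); ring.
have Xmarkov : spine_markov F Q mu n (spine_offspring q)
    (rank_at (spine_word q)) P x mo th G.
  exact: (branching_spine_markov bmpX t uh).
have Ymarkov : spine_markov F Q mu n (spine_offspring q)
    (rank_at (spine_word q)) P' (holding (jumps Y)) (aux_motion Y)
    (aux_theta Y) G'.
  exact: (@auxiliary_spine_markov _ _ _ _ _ _ _ _ _ _ _ auxY t n).
have dlaw : proportional_laws P P' G G' growth (spine_data n x mo th n.+1)
    (spine_data n (holding (jumps Y)) (aux_motion Y) (aux_theta Y) n.+1).
  apply: (spine_data_law polishE mF jh mG mG' _ _ _ _ _ _ Xmarkov Ymarkov) => //.
  - by move=> i; exact: ml.
  - by move=> i; exact: measurable_motion bmpX _.
  - by move=> i; exact: measurable_theta bmpX _.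
  - exact: measurable_aux_motion auxY.
  - exact: measurable_aux_theta auxY.
have [] := spine_integral polishE mG mG' _ _
  (@branching_follows_spine _ _ _ _ X t (spine_word q) (spine_offspring q))
  (@auxiliary_follows_spine _ _ _ _ Y t n (spine_offspring q)
    (rank_at (spine_word q))) dlaw mf f0.
- apply: measurable_spine_data => [i|i _|i _]; first exact: ml.
    exact: measurable_motion bmpX _.
  exact: measurable_theta bmpX _.
- apply: measurable_spine_data => [i|i _|i _]; first exact: mh.
    exact: measurable_aux_motion auxY _.
  exact: measurable_aux_theta auxY _.
by split.
Qed.

Lemma branching_eventP q w : branching_event q w <->
  alive_at X t w (spine_word q) /\
  forall i, (i < size (spine_word q))%N ->
    offspring X (take i (spine_word q)) w = spine_offspring q i.
Proof.
set u := spine_word q.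
have birthE : birth (life X ^~ w) u = \sum_(i < size u) life X (take i u) w.
  by rewrite -[in LHS](take_size u) birth_take.
have deathE : death (life X ^~ w) u = \sum_(i < (size u).+1) life X (take i u) w.
  by rewrite -[in LHS](take_size u) death_take.
rewrite /alive_at /alive /= birthE deathE; split.
  move=> [qa [qm ql]]; split => //; split => //.
  by apply/treeP => i iu; rewrite [offspring _ _ _]qm//; exact: (admissibleP _ qa).
move=> [[/treeP uT ul] qm]; split; last by split.
by apply/admissibleP => i iu; rewrite -qm//; exact: uT.
Qed.

(** [spine_word] is a bijection from the spines whose event occurs at [w] onto the words alive at
    [t]: the inverse attaches to each strict prefix its actual number of offspring. *)
Lemma branching_esum w (f : word -> \bar R) :
  (\esum_(u in alive_at X t w) f u =
   \esum_(q in [set q | branching_event q w]) f (spine_word q))%E.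
Proof.
apply: reindex_esum; split.
- by move=> q /branching_eventP[].
- move=> q q'; rewrite !inE => /branching_eventP[_ qm] /branching_eventP[_ qm'] uu.
  apply: spine_eq => // i iu; rewrite -qm// uu -qm'// -uu//.
- move=> u uV.
  exists (zip u [seq offspring X (take i u) w | i <- iota 0 (size u)]).
    apply/branching_eventP; rewrite /spine_word /spine_offspring.
    rewrite unzip1_zip ?size_map ?size_iota//.
    split => // i iu; rewrite unzip2_zip ?size_map ?size_iota//.
    by rewrite (nth_map 0%N) ?size_iota// nth_iota.
  by rewrite /= /spine_word unzip1_zip// size_map size_iota.
Qed.

(** The spine is read off from the jumps up to time [t]: their number gives the length, the child
    indices the word, and the marks the offspring numbers. *)
Lemma auxiliary_event_unique w :
  exists q, [set q | auxiliary_event q w] = [set q].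
Proof.
pose n := jump_count (jumps Y) t w.
have nE k : alive_event k t (holding (jumps Y)) w <-> n = k.
  rewrite /alive_event /= -(jump_count_alive (E := E))//.
  by split=> /eqP.
(* The default [label1] is never reached, because child indices are positive. *)
pose lab (k : nat) : label := insubd label1 k.
have labE i : val (lab (child_index Y i w)) = child_index Y i w.
  by rewrite /lab val_insubd; have /andP[-> _] := index_itv Y i w.
pose q := zip [seq lab (child_index Y i w) | i <- iota 0 n]
              [seq mark Y i w | i <- iota 0 n].
have uE : spine_word q = [seq lab (child_index Y i w) | i <- iota 0 n].
  by rewrite /spine_word unzip1_zip// !size_map.
have hE : unzip2 q = [seq mark Y i w | i <- iota 0 n].
  by rewrite unzip2_zip// !size_map.
have su : size (spine_word q) = n by rewrite uE size_map size_iota.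
have rE i : (i < n)%N -> rank_at (spine_word q) i = child_index Y i w.
  by move=> i_n; rewrite /rank_at uE (nth_map 0%N) ?size_iota// nth_iota.
have oE i : (i < n)%N -> spine_offspring q i = mark Y i w.
  by move=> i_n; rewrite /spine_offspring hE (nth_map 0%N) ?size_iota// nth_iota.
exists q; apply/seteqP; split=> [q' [_ [[qm /nE nq'] qi]]|_ ->]; last first.
  split.
    apply/admissibleP => i; rewrite su => i_n; rewrite rE// oE//.
    by have /andP[] := index_itv Y i w.
  split; first split.
  - by move=> i; rewrite su => i_n; rewrite oE.
  - by rewrite su; exact/nE.
  - by move=> i; rewrite su => i_n; rewrite rE.
apply: spine_eq; last first.
  by move=> i iq'; rewrite -qm// oE// nq'.
apply: (@eq_from_nth _ label1) => [|i iq']; first by rewrite su nq'.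
apply: val_inj; rewrite -!/(rank_at _ _) -qi// rE// nq'//.
Qed.

(** Both integrands become sums over all spines of functions cut off to spine events. On the right
    exactly one event occurs, so the sum is [f] itself. Sum and integral are then exchanged and the
    spines compared one by one. *)
Lemma many_to_one (f : cadlag_path [set` `[0, t]] (E * R)%type -> \bar R) :
  measurable_fun [set: cadlag_path [set` `[0, t]] (E * R)%type] f ->
  (forall h, 0 <= f h)%E ->
  (\int[P]_w (\esum_(u in alive_at X t w) f (lineage X u t w)) =
   growth%:num%:E * \int[P']_w f (aux_path Y t w))%E.
Proof.
move=> mf f0.
pose fX q w := f (lineage X (spine_word q) t w).
pose fY w := f (aux_path Y t w).
have patch0 (U : Type) (A : set U) (g : U -> \bar R) x :
    (forall y, 0 <= g y)%E -> (0 <= (g \_ A) x)%E.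
  by move=> g0; rewrite patchE; case: ifP.
transitivity (\int[P]_w (\esum_(q in [set: seq (label * nat)])
    (fX q \_ (branching_event q)) w))%E.
  apply: eq_integral => w _.
  rewrite (branching_esum _ (fun u => f (lineage X u t w))).
  rewrite [LHS]esum_mkcond; apply: eq_esum => q _; rewrite patchE /fX.
  by congr (if _ then _ else _); apply/idP/idP; rewrite !inE.
transitivity (growth%:num%:E * \int[P']_w (\esum_(q in [set: seq (label * nat)])
    (fY \_ (auxiliary_event q)) w))%E; last first.
  congr (_ * _)%E; apply: eq_integral => w _.
  have [q qE] := auxiliary_event_unique w.
  transitivity (\esum_(q' in [set q]) fY w)%E; last first.
    by rewrite esum_set1//; exact: f0.
  rewrite -qE [RHS]esum_mkcond.
  apply: eq_esum => q' _; rewrite patchE.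
  by congr (if _ then _ else _); apply/idP/idP; rewrite !inE.
rewrite !ge0_integral_esum; last 4 first.
- move=> q; have [_ mG' _ mZ' _] := spine_many_to_one q mf f0.
  by apply/(measurable_restrictT _ mG'); exact: measurableT_comp.
- by move=> q w; apply: patch0 => y; exact: f0.
- move=> q; have [mG _ mZ _ _] := spine_many_to_one q mf f0.
  by apply/(measurable_restrictT _ mG); exact: measurableT_comp.
- by move=> q w; apply: patch0 => y; exact: f0.
rewrite -ge0_esumZl//; last first.
  by move=> q; apply: integral_ge0 => w _; apply: patch0 => y; exact: f0.
apply: eq_esum => q _; rewrite -[LHS]integral_mkcond.
rewrite -[X in (_ * X)%E]integral_mkcond.
by have [_ _ _ _] := spine_many_to_one q mf f0.
Qed.

End spine_decomposition.

Theorem proposition3p3 (R : realType) (r : R) (p : probability nat R)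
  (E : ptopologicalType)
  (Q : R.-pker (borel E) ~> (cadlag_path (half_line R) E))
  (F : nat -> nat -> E * R -> E)
  (r_gt0 : 0 < r)
  (p1 : p [set 1%N] = 0%E)
  (p_second_moment : (second_moment p < +oo)%E)
  (mean_gt0 : 0 < mean p)
  (polishE : polish R E)
  (markovQ : strong_markov Q)
  (mF : forall k j : nat, (0 < j <= k)%N ->
    @measurable_fun _ _ (borel E * R)%type (borel E)
      ([set: E] `*` [set` `[0, 1]]) (F k j))
  (t : R) (t_ge0 : 0 <= t)
  (mu : probability (borel E) R)
  (d : measure_display) (Om : measurableType d) (P : probability Om R)
  (X : branching_data Om E) (bmpX : branching_process X F Q mu P r p)
  (d' : measure_display) (Om' : measurableType d') (P' : probability Om' R)
  (Y : auxiliary_data Om' E) (auxY : auxiliary_process Y F Q mu P' r p)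
  (f : cadlag_path [set` `[0, t]] (E * R)%type -> R)
  (mf : measurable_fun [set: cadlag_path [set` `[0, t]] (E * R)%type] f)
  (f_ge0 : forall h, 0 <= f h) :
  ((\int[P]_w \esum_(u in alive_at X t w) (f (lineage X u t w))%:E) /
   (\int[P]_w counting (alive_at X t w)) =
   \int[P']_w (f (aux_path Y t w))%:E)%E.
Proof.
have m2o := many_to_one r_gt0 mean_gt0 polishE mF t_ge0 bmpX auxY.
(* The expected population size is the many-to-one formula for the constant function 1. *)
have countE : (\int[P]_w counting (alive_at X t w) = (growth r p t)%:num%:E)%E.
  under eq_integral do rewrite counting_esum.
  rewrite (m2o (fun=> 1%E))//.
  rewrite integral_cst// mul1e -[RHS]mule1; congr (_ * _)%E.
  exact: probability_setT.
rewrite countE (m2o (fun h => (f h)%:E)); last 2 first.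
- exact/measurable_EFinP.
- by move=> h; rewrite lee_fin.
(* The factor is finite and positive, so it cancels even when the expectation of [f] is infinite. *)
have c0 : (growth r p t)%:num != 0 by rewrite gt_eqF// expR_gt0.
rewrite inver (negbTE c0) [LHS]muleAC -EFinM mulfV//.
by rewrite mul1e.
Qed.
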